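(* Let $n\ge1$, $m\ge0$ be integers, let $t_1,\ldots,t_{2n+2m+4}\in\mathbb C^*$ satisfy $|t_r|<1$ and $\prod_{r=1}^{2n+2m+4}t_r=(pq)^{m+1}$, and let $a_1,\ldots,a_n,b_1,\ldots,b_n\in\mathbb C^*$ be such that $\theta_p(a_ia_j^{\pm1})\neq0$ and $\theta_q(b_ib_j^{\pm1})\ne0$ for all $i<j$. Then $$ I_n^{(m)}(t_1,\ldots,t_{2n+2m+4})= \prod_{1\leq i<j\leq n} \frac{1}{a_j\theta_p(a_ia_j^{\pm 1})\,b_j\theta_q(b_ib_j^{\pm 1})} $$ $$ \times \det_{1\le i,j\le n}\left(\kappa\int_{\mathbb T} \frac{\prod_{r=1}^{2n+2m+4} \Gamma_{p,q}(t_r z^{\pm 1})}{\Gamma_{p,q}(z^{\pm2})} \prod_{\substack{1\le k\le n\\ k\ne i}} \theta_p(a_kz^{\pm 1}) \prod_{\substack{1\le k\le n\\ k\ne j}} \theta_q(b_kz^{\pm 1}) \; \frac{dz}{2\pi\sqrt{-1}z} \right), $$ where $\kappa=(p;p)_\infty (q;q)_\infty/2$.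
   Context: Fix $p,q\in\mathbb C$ with $0<|p|,|q|<1$. Set $(z;p)_\infty=\prod_{k\ge0}(1-zp^k)$, $\theta_p(z)=(z;p)_\infty(pz^{-1};p)_\infty$, $\theta_p(tz^{\pm1})=\theta_p(tz)\theta_p(tz^{-1})$, and similarly with $q$. For $z\in\mathbb C^*$ set $$\Gamma_{p,q}(z)=\prod_{j,k=0}^\infty\frac{1-z^{-1}p^{j+1}q^{k+1}}{1-zp^jq^k},$$ with conventions $\Gamma_{p,q}(tz^{\pm1})=\Gamma_{p,q}(tz)\Gamma_{p,q}(tz^{-1})$, $\Gamma_{p,q}(z^{\pm2})=\Gamma_{p,q}(z^2)\Gamma_{p,q}(z^{-2})$, and $\Gamma_{p,q}(z_1^{\pm1}z_2^{\pm1})$ = product of $\Gamma_{p,q}$ over the four sign choices. $\mathbb T$ is the positively oriented unit circle and $\kappa_n=\frac{(p;p)_\infty^n(q;q)_\infty^n}{2^n n!}$. For $|t_j|<1$ with $\prod_{j=1}^{2n+2m+4}t_j=(pq)^{m+1}$, $$ I_n^{(m)}(t_1,\ldots,t_{2n+2m+4})=\kappa_n\int_{\mathbb T^n} \prod_{1\leq i<j\leq n} \frac{1}{\Gamma_{p,q}(z_i^{\pm 1}z_j^{\pm 1})} \prod_{j=1}^n\frac{\prod_{i=1}^{2n+2m+4}\Gamma_{p,q}(t_iz_j^{\pm 1})} {\Gamma_{p,q}(z_j^{\pm 2})}\frac{dz_j}{2\pi\sqrt{-1}z_j}. $$ *)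

(* Defs.v *)
From mathcomp Require Import all_boot all_order all_algebra.
From mathcomp Require Import complex.
From mathcomp Require Import all_classical all_reals all_analysis.

Set Implicit Arguments.
Unset Strict Implicit.
Unset Printing Implicit Defensive.

Import Order.TTheory GRing.Theory Num.Theory.
Import numFieldNormedType.Exports.

Local Open Scope classical_set_scope.
Local Open Scope ring_scope.
Local Open Scope complex_scope.

Section EllipticFunctions.
Context {R : realType}.
Local Notation C := R[i].

(* (z; p)_oo.  C^o is C with the topology of its norm. *)
Definition qpoch (z p : C) : C :=
  let u : nat -> C^o := fun N => \prod_(0 <= k < N) (1 - z * p ^+ k) in
  lim (u @ \oo).

Definition theta (p z : C) : C := qpoch z p * qpoch (p * z^-1) p.

(* The double product converges absolutely, so it is taken along the square
   partial products.  As 0^-1 = 0, the value at a pole z = p^(-j) q^(-k) is 0;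
   hence (egamma p q z)^-1 is 0 there, the value of the analytic continuation of
   the reciprocal. *)
Definition egamma (p q z : C) : C :=
  let u : nat -> C^o := fun N =>
    \prod_(0 <= j < N) \prod_(0 <= k < N)
      ((1 - z^-1 * p ^+ j.+1 * q ^+ k.+1) / (1 - z * p ^+ j * q ^+ k)) in
  lim (u @ \oo).

(* f(t z^{+-1}) *)
Definition pm1 (f : C -> C) (t z : C) : C := f (t * z) * f (t * z^-1).

(* f(z^{+-2}) *)
Definition pm2 (f : C -> C) (z : C) : C := f (z ^+ 2) * f (z ^- 2).

(* f(z^{+-1} w^{+-1}) *)
Definition pmpm (f : C -> C) (z w : C) : C :=
  f (z * w) * f (z * w^-1) * f (z^-1 * w) * f (z^-1 * w^-1).

End EllipticFunctions.

Section ContourIntegrals.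
Context {R : realType}.
Local Notation C := R[i].

Definition expi (x : R) : C := cos x +i* sin x.

Definition cRintegral (D : set R) (f : R -> C) : C :=
  Rintegral lebesgue_measure D (fun x => complex.Re (f x)) +i*
  Rintegral lebesgue_measure D (fun x => complex.Im (f x)).

(* The integral of f(z) dz along z = e^{ix}, 0 <= x <= 2 pi, where
   dz = i e^{ix} dx. *)
Definition circle_integral (f : C -> C) : C :=
  cRintegral `[0, 2 * pi] (fun x => f (expi x) * ('i%C * expi x)).

(* The integral of F(z_1, ..., z_n) dz_1 ... dz_n over T^n, as an iterated
   contour integral. *)
Fixpoint torus_integral (n : nat) : (n.-tuple C -> C) -> C :=
  match n with
  | 0 => fun F => F [tuple]
  | n'.+1 => fun F =>
      circle_integral (fun z => torus_integral (fun w => F [tuple of z :: w]))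
  end.

(* 2 pi sqrt(-1) *)
Definition two_pi_i : C := (2 * pi)%:C * 'i%C.

End ContourIntegrals.

Section EllipticIntegrals.
Context {R : realType}.
Local Notation C := R[i].

Definition kappa (p q : C) (n : nat) : C :=
  qpoch p p ^+ n * qpoch q q ^+ n / (2 ^+ n * n`!%:R).

Definition ell_integral (p q : C) (n m : nat)
    (t : 'I_(2 * n + 2 * m + 4) -> C) : C :=
  kappa p q n *
  torus_integral (fun z : n.-tuple C =>
    (\prod_(i < n) \prod_(j < n | (i < j)%N)
       (pmpm (egamma p q) (tnth z i) (tnth z j))^-1) *
    \prod_(j < n)
      ((\prod_(i < 2 * n + 2 * m + 4) pm1 (egamma p q) (t i) (tnth z j))
         / pm2 (egamma p q) (tnth z j)
         * (two_pi_i * tnth z j)^-1)).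

End EllipticIntegrals.

Arguments ell_integral {R} p q n m t.

(* Main.v *)
Require Import Defs.
From mathcomp Require Import all_boot all_order all_algebra.
From mathcomp Require Import perm complex.
From mathcomp Require Import all_classical all_reals all_analysis.
From mathcomp Require Import measurable_realfun.
From mathcomp Require Import ring lra zify.

Set Implicit Arguments.
Unset Strict Implicit.
Unset Printing Implicit Defensive.

Import Order.TTheory GRing.Theory Num.Theory.
Import numFieldNormedType.Exports.
Import Normc.

Local Open Scope classical_set_scope.
Local Open Scope ring_scope.
Local Open Scope complex_scope.

(** Write [x, y]_p = x^-1 theta_p(x y) theta_p(x / y), the function [theta_br].

    On the unit circle the reflection formula
    1 / (Gamma(x) Gamma(1/x)) = theta_p(x) theta_q(1/x) ([egamma_reflect]) turns
    each cross factor 1 / Gamma(z_i^{+-1} z_j^{+-1}) into the product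
    [z_i, z_j]_p [z_i, z_j]_q ([pmpm_gamma]).  So the integrand is a product of
    one-variable weights, times prod_{i<j} [z_i, z_j]_p, times the same product
    with q.

    The bracket [x, y]_p is antisymmetric and satisfies the Pluecker (addition)
    relation ([theta_br_pluecker]); hence, as soon as it does not vanish
    identically, it has the form phi(x) psi(y) - psi(x) phi(y), and Lagrange
    interpolation for binary forms gives ([det_bracket], [det_theta])

      det (prod_{k <> i} theta_p(a_k z_j^{+-1}))
        = (+-1) prod_{i<j} a_j theta_p(a_i a_j^{+-1}) prod_{i<j} [z_i, z_j]_p,

    with a sign that depends only on n.  The products over the a_i and over the
    b_i do not vanish, so the integrand is a constant times a product of two
    determinants, one for p and one for q, times one-variable weights.  Expanding
    both determinants over permutations and integrating each variable separately
    ([torus_integral_sum_prod]) leaves n! times the determinant of the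
    one-variable integrals ([andreief]), and the factor n! is absorbed by
    kappa_n n! = kappa^n.

    The Pluecker relation is read off the Laurent expansion of theta_p.  By the
    q-binomial theorem the truncated product for theta_p(z) is the sum of
    (-1)^n p^(n(n-1)/2) z^n over |n| <= N, each term being weighted by a
    q-binomial coefficient that is bounded and converges, as N grows, to a limit
    that does not depend on n.  Multiplying the expansions at x z and x / z and
    sorting the pairs of exponents (m, n) by the parity of m + n, one sees that
    theta_p(x z) theta_p(x / z) is, up to a constant, the limit of
    x (O_N(x) E_N(z) - E_N(x) O_N(z)), an expression of rank two, where E_N and
    O_N are the finite sums [theta_even] and [theta_odd] ([theta_br_cvg]).
    Passage to the limit is dominated convergence ([tannery_exhaust]). *)


(** * A Lagrange-interpolation determinant *)

Section HomogeneousVandermonde.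

(** The homogeneous Vandermonde product of n vectors (X i, Y i) of the plane. *)
Definition hvander (F : comNzRingType) n (X Y : 'I_n -> F) : F :=
  \prod_(i < n) \prod_(j < n | (i < j)%N) (X i * Y j - Y i * X j).

(** The sign (-1)^(n (n - 1) / 2), written as a product over pairs so that it
    can be merged with the other products over pairs. *)
Definition pair_sign (F : nzRingType) n : F :=
  \prod_(i < n) \prod_(j < n | (i < j)%N) (-1).

Lemma pair_signM (F : comNzRingType) n : pair_sign F n * pair_sign F n = 1.
Proof.
rewrite -big_split big1 //= => i _.
by rewrite -big_split big1 //= => j _; rewrite mulrNN mulr1.
Qed.

(** A product over ordered pairs of distinct indices splits into the pairs with
    i < j and their transposes. *)
Lemma prod_pairsC (F : comNzRingType) n (f : 'I_n -> 'I_n -> F) :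
  \prod_(j < n) \prod_(k < n | k != j) f k j =
  (\prod_(i < n) \prod_(j < n | (i < j)%N) f i j) *
  (\prod_(i < n) \prod_(j < n | (i < j)%N) f j i).
Proof.
transitivity ((\prod_(j < n) \prod_(k < n | (k < j)%N) f k j) *
  (\prod_(j < n) \prod_(k < n | (j < k)%N) f k j)).
  rewrite -big_split /=; apply: eq_bigr => j _.
  rewrite (bigID (fun k : 'I_n => (k < j)%N)) /=; congr (_ * _); apply: eq_bigl => k.
    by case: ltngtP => [h|h|/val_inj h]; rewrite ?h ?eqxx ?andbT ?andbF //;
      rewrite -val_eqE /= ltn_eqF.
  by case: (ltngtP k j) => [h|h|/val_inj h]; rewrite ?h ?eqxx ?andbT ?andbF //;
    rewrite -val_eqE /= gtn_eqF.
congr (_ * _).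
by rewrite (exchange_big_dep xpredT) //=.
Qed.

(** When no Y j vanishes, dividing the j-th column by Y j ^ (n - 1) reduces the
    homogeneous Vandermonde matrix to the usual one at the points X j / Y j. *)
Lemma det_hvander_neq0 (F : fieldType) n (X Y : 'I_n -> F) :
  (forall j, Y j != 0) ->
  \det (\matrix_(l < n, j < n) (X j ^+ l * Y j ^+ (n.-1 - l))) =
  \prod_(i < n) \prod_(j < n | (i < j)%N) (X j * Y i - X i * Y j).
Proof.
move=> Y0.
have -> : (\matrix_(l < n, j < n) (X j ^+ l * Y j ^+ (n.-1 - l))) =
   Vandermonde n (\row_j (X j / Y j)) *m diag_mx (\row_j Y j ^+ n.-1).
  apply/matrixP => l j; rewrite mul_mx_diag !mxE expr_div_n -mulrA; congr (_ * _).
  have ln : (l <= n.-1)%N by rewrite -ltnS (leq_trans (ltn_ord l)) // leqSpred.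
  by rewrite -{2}(subnK ln) exprD mulrCA mulVf ?mulr1 // expf_neq0.
rewrite det_mulmx det_Vandermonde det_diag.
have -> : \prod_(i < n) (\row_j Y j ^+ n.-1) 0 i =
   \prod_(i < n) \prod_(j < n | (i < j)%N) (Y i * Y j).
  transitivity (\prod_(j < n) \prod_(k < n | k != j) Y j).
    apply: eq_bigr => i _; rewrite mxE prodr_const; congr (_ ^+ _).
    by rewrite -[in LHS](card_ord n) -(cardC1 i).
  rewrite prod_pairsC -big_split; apply: eq_bigr => i _.
  by rewrite -big_split; apply: eq_bigr => j _; rewrite /= mulrC.
rewrite -big_split; apply: eq_bigr => i _.
rewrite -big_split; apply: eq_bigr => j _; rewrite /= !mxE.
by have := Y0 i; have := Y0 j => h1 h2; field; rewrite h1 h2.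
Qed.

(** The general case follows by replacing Y j with the nonzero
    polynomial 'X + Y j, working in the field of fractions, and evaluating the
    resulting polynomial identity at 0. *)
Lemma det_hvander (F : fieldType) n (X Y : 'I_n -> F) :
  \det (\matrix_(l < n, j < n) (X j ^+ l * Y j ^+ (n.-1 - l))) =
  pair_sign F n * hvander X Y.
Proof.
pose f := (@tofrac {poly F} : {poly F} -> {fraction {poly F}}).
pose X' j : {poly F} := (X j)%:P.
pose Y' j : {poly F} := 'X + (Y j)%:P.
have Y0 j : f (Y' j) != 0.
  by rewrite tofrac_eq0 /Y' -size_poly_eq0 size_XaddC.
have := @det_hvander_neq0 _ n (f \o X') (f \o Y') Y0.
have -> : (\matrix_(l < n, j < n) ((f \o X') j ^+ l * (f \o Y') j ^+ (n.-1 - l))) =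
  map_mx (@tofrac {poly F}) (\matrix_(l < n, j < n) (X' j ^+ l * Y' j ^+ (n.-1 - l))).
  by apply/matrixP => i j; rewrite !mxE /= /f rmorphM !rmorphXn.
rewrite det_map_mx.
have -> : \prod_(i < n) \prod_(j < n | (i < j)%N)
     ((f \o X') j * (f \o Y') i - (f \o X') i * (f \o Y') j) =
  @tofrac {poly F} (\prod_(i < n) \prod_(j < n | (i < j)%N) (X' j * Y' i - X' i * Y' j)).
  rewrite rmorph_prod; apply: eq_bigr => i _.
  by rewrite rmorph_prod; apply: eq_bigr => j _; rewrite /= /f rmorphB !rmorphM.
move/eqP; rewrite tofrac_eq => /eqP /(congr1 (horner_eval 0)).
rewrite -det_map_mx rmorph_prod /= => E.
transitivity (\det (map_mx (horner_eval 0)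
   (\matrix_(l < n, j < n) (X' j ^+ l * Y' j ^+ (n.-1 - l))))).
  by congr (\det _); apply/matrixP => i j; rewrite !mxE /= /horner_eval hornerM !horner_exp hornerD hornerX !hornerC add0r.
rewrite E /pair_sign /hvander -big_split /=; apply: eq_bigr => i _.
rewrite rmorph_prod -big_split /=; apply: eq_bigr => j _.
by rewrite /horner_eval !(hornerD, hornerN, hornerM, hornerX, hornerC); ring.
Qed.

(** A product of linear forms is a binary form with coefficients that do not
    depend on the variables X, Y. *)
Lemma prod_linear_forms (F : comNzRingType) (I : Type) (s : seq I) (u v : I -> F) :
  exists c : nat -> F, forall X Y,
    \prod_(k <- s) (u k * Y - v k * X) =
    \sum_(l < (size s).+1) c l * (X ^+ l * Y ^+ (size s - l)).
Proof.
elim: s => [|k s [c IH]].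
  by exists (fun=> 1) => X Y; rewrite big_nil big_ord1 !mulr1.
exists (fun l => u k * (if (l <= size s)%N then c l else 0) -
                 v k * (if l is l'.+1 then c l' else 0)) => X Y.
rewrite big_cons IH /=; set n := size s.
under [RHS]eq_bigr => l _ do rewrite mulrBl.
rewrite sumrB [X in _ = X - _]big_ord_recr /= ltnn mulr0 mul0r addr0.
rewrite [X in _ - X]big_ord_recl /= mulr0 mul0r add0r mulrBl !mulr_sumr.
congr (_ - _); apply: eq_bigr => l _; last first.
  by rewrite subSS exprS; ring.
have ln := ltn_ord l.
by rewrite -ltnS ln subSn // exprS; ring.
Qed.

(** Lagrange interpolation for binary forms of degree n - 1.  The matrix is the
    product of a matrix C of coefficients with a homogeneous Vandermonde matrix.
    At (X, Y) = (u, v) it is diagonal, which determines det C. *)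
Lemma det_hlagrange (F : fieldType) n (u v X Y : 'I_n -> F) :
  hvander u v != 0 ->
  \det (\matrix_(i < n, j < n) \prod_(k < n | k != i) (u k * Y j - v k * X j)) =
  pair_sign F n * hvander u v * hvander X Y.
Proof.
move=> V0.
have [c cP] : exists c : 'I_n -> nat -> F, forall i X Y,
    \prod_(k < n | k != i) (u k * Y - v k * X) =
    \sum_(l < n) c i l * (X ^+ l * Y ^+ (n.-1 - l)).
  have H (i : 'I_n) : exists c : {ffun 'I_n -> F}, forall X Y,
    \prod_(k < n | k != i) (u k * Y - v k * X) =
    \sum_(l < n) c l * (X ^+ l * Y ^+ (n.-1 - l)).
    pose s := [seq k <- index_enum 'I_n | k != i].
    have ss : size s = n.-1.
      rewrite size_filter -sum1_count sum1_card -[in RHS](card_ord n).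
      by rewrite -(cardC1 i); apply: eq_card.
    have n0 : n.-1.+1 = n by case: (n) i {s ss} => [[]|].
    have [c cP] := prod_linear_forms s u v.
    exists [ffun l : 'I_n => c l] => X' Y'; rewrite -big_filter -/s cP ss n0.
    by apply: eq_bigr => l _; rewrite ffunE.
  have /fin_all_exists[c cP] := H.
  exists (fun i l => if insub l is Some l' then c i l' else 0) => i X' Y'; rewrite cP.
  by apply: eq_bigr => l _; rewrite valK.
pose C := \matrix_(i < n, l < n) c i l.
have E (X' Y' : 'I_n -> F) :
  \det (\matrix_(i < n, j < n) \prod_(k < n | k != i) (u k * Y' j - v k * X' j)) =
  \det C * (pair_sign F n * hvander X' Y').
  rewrite -det_hvander -det_mulmx; congr (\det _); apply/matrixP => i j.
  by rewrite !mxE cP; apply: eq_bigr => l _; rewrite !mxE.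
have D : \det C = hvander u v.
  have s0 : pair_sign F n * hvander u v != 0.
    rewrite mulf_neq0 //; apply/eqP => s0; have := pair_signM F n.
    by rewrite s0 mul0r => /eqP; rewrite eq_sym oner_eq0.
  apply: (mulIf s0); rewrite -E.
  have -> : (\matrix_(i < n, j < n) \prod_(k < n | k != i) (u k * v j - v k * u j)) =
     diag_mx (\row_j \prod_(k < n | k != j) (u k * v j - v k * u j)).
    apply/matrixP => i j; rewrite !mxE; have [->//|ij] := eqVneq i j.
    by rewrite mulr0n (bigD1 j) 1?eq_sym //= [v j * u j]mulrC subrr mul0r.
  rewrite det_diag; under eq_bigr do rewrite mxE.
  rewrite prod_pairsC; congr (_ * _).
  rewrite /pair_sign /hvander -big_split; apply: eq_bigr => i _ /=.
  by rewrite -big_split; apply: eq_bigr => j _ /=; ring.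
by rewrite E D; ring.
Qed.

(** An antisymmetric bracket satisfying the Pluecker relation behaves like the
    determinant of two plane vectors: the interpolation formula holds for it.  The
    predicate P is the domain on which the relations are known. *)
Lemma det_bracket (F : fieldType) (T : Type) (P : T -> Prop) (br : T -> T -> F) n
  (a z : 'I_n -> T) :
  (forall x y, P x -> P y -> br x y = - br y x) ->
  (forall x y z w, P x -> P y -> P z -> P w ->
     br x y * br z w - br x z * br y w + br x w * br y z = 0) ->
  (forall i, P (a i)) -> (forall i, P (z i)) ->
  (forall i j : 'I_n, (i < j)%N -> br (a i) (a j) != 0) ->
  \det (\matrix_(i < n, j < n) \prod_(k < n | k != i) br (a k) (z j)) =
  pair_sign F n *
  (\prod_(i < n) \prod_(j < n | (i < j)%N) br (a i) (a j)) *
  (\prod_(i < n) \prod_(j < n | (i < j)%N) br (z i) (z j)).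
Proof.
move=> anti pl Pa Pz a0; case: n a z Pa Pz a0 => [|[|n]] a z Pa Pz a0.
- by rewrite det_mx00 /pair_sign !big_ord0 !mulr1.
- rewrite det_mx11 mxE /pair_sign !big_ord1 !big_pred0 ?mulr1 //; move=> i;
    by rewrite (ord1 i).
(* For n >= 2 two of the interpolation points have a nonzero bracket; they
   serve as a basis of the plane. *)
pose c := a ord0; pose d := a (lift ord0 ord0).
have Pc : P c by exact: Pa. have Pd : P d by exact: Pa.
have cd0 : br c d != 0 by exact: a0.
pose phi x := br x c / br c d; pose psi x := br x d.
(* The Pluecker relation at x, y, c, d gives the rank-two form of the bracket. *)
have E x y : P x -> P y -> br x y = phi x * psi y - psi x * phi y.
  move=> Px Py; have := pl x y c d Px Py Pc Pd.
  rewrite /phi /psi => H; apply: (mulIf cd0).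
  have -> : br x y * br c d = br x c * br y d - br x d * br y c.
    by apply/eqP; rewrite -subr_eq0 -[X in _ == X]H; apply/eqP; ring.
  by field.
have V0 : hvander (phi \o a) (psi \o a) != 0.
  apply/prodf_neq0 => i _; apply/prodf_neq0 => j ij /=.
  by rewrite -E //; exact: a0.
have := det_hlagrange (phi \o z) (psi \o z) V0.
have -> : \matrix_(i, j) (\prod_(k | k != i)
    ((phi \o a) k * (psi \o z) j - (psi \o a) k * (phi \o z) j)) =
  \matrix_(i, j) \prod_(k | k != i) br (a k) (z j).
  by apply/matrixP => i j; rewrite !mxE; apply: eq_bigr => k _; rewrite /= -E.
move=> ->; congr (_ * _ * _); apply: eq_bigr => i _; apply: eq_bigr => j _ /=;
  by rewrite -E.
Qed.

End HomogeneousVandermonde.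

(** * Limits and infinite products of complex numbers *)

Section ComplexLimits.
Context {R : realType}.
Local Notation C := R[i].
Implicit Types (x y z : C) (u v : nat -> C).

Lemma normCE z : `|z| = (normc z)%:C.
Proof. by []. Qed.

Lemma normc_ge0 z : 0 <= normc z.
Proof. by rewrite -ler0c -normCE normr_ge0. Qed.

Lemma normc_le0D x y : normc (x + y) <= normc x + normc y.
Proof. by rewrite -lecR rmorphD /= -!normCE ler_normD. Qed.

Lemma normc_opp z : normc (- z) = normc z.
Proof. by apply: complexI; rewrite -!normCE normrN. Qed.

Lemma normcX z n : normc (z ^+ n) = normc z ^+ n.
Proof. by elim: n => [|n IH]; rewrite ?normc1 // !exprS normcM IH. Qed.

Lemma normc_prod (I : Type) (s : seq I) (P : pred I) (f : I -> C) :
  normc (\prod_(i <- s | P i) f i) = \prod_(i <- s | P i) normc (f i).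
Proof.
by elim/big_rec2: _ => [|i x y _ <-]; rewrite ?normc1 // normcM.
Qed.

Lemma normc_sum (I : Type) (s : seq I) (P : pred I) (f : I -> C) :
  normc (\sum_(i <- s | P i) f i) <= \sum_(i <- s | P i) normc (f i).
Proof.
elim/big_rec2: _ => [|i x y _ h]; first by rewrite normc0.
by apply: le_trans (normc_le0D _ _) _; rewrite lerD2l.
Qed.

Lemma cReD x y : complex.Re (x + y) = complex.Re x + complex.Re y.
Proof. by case: x y => [a b] [c d]. Qed.

Lemma cImD x y : complex.Im (x + y) = complex.Im x + complex.Im y.
Proof. by case: x y => [a b] [c d]. Qed.

Lemma cReB x y : complex.Re (x - y) = complex.Re x - complex.Re y.
Proof. by case: x y => [a b] [c d]. Qed.

Lemma cImB x y : complex.Im (x - y) = complex.Im x - complex.Im y.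
Proof. by case: x y => [a b] [c d]. Qed.

Lemma Re_le_normc z : `|complex.Re z| <= normc z.
Proof. by have := normc_ge_Re z; rewrite normCE lecR. Qed.

Lemma Im_le_normc z : `|complex.Im z| <= normc z.
Proof.
have := Re_le_normc (z * 'i); rewrite ReiNIm normrN normcM.
by rewrite [normc 'i](_ : _ = 1) ?mulr1 //= expr0n expr1n add0r sqrtr1.
Qed.

Lemma normc_le_ReIm z : normc z <= `|complex.Re z| + `|complex.Im z|.
Proof.
have {1}-> : z = (complex.Re z)%:C + 'i * (complex.Im z)%:C by exact: complexE.
apply: le_trans (normc_le0D _ _) _; apply: lerD.
  by rewrite /= expr0n addr0 sqrtr_sqr.
rewrite normcM [normc 'i](_ : _ = 1) ?mul1r; last by rewrite /= expr0n expr1n add0r sqrtr1.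
by rewrite /= expr0n addr0 sqrtr_sqr.
Qed.

Lemma rcvgD (f g : nat -> R) (a b : R) : f @ \oo --> a -> g @ \oo --> b ->
  (fun n => f n + g n) @ \oo --> a + b.
Proof. by move=> h1 h2; exact: cvgD. Qed.

Lemma rcvgB (f g : nat -> R) (a b : R) : f @ \oo --> a -> g @ \oo --> b ->
  (fun n => f n - g n) @ \oo --> a - b.
Proof. by move=> h1 h2; exact: cvgB. Qed.

Lemma rcvgM (f g : nat -> R) (a b : R) : f @ \oo --> a -> g @ \oo --> b ->
  (fun n => f n * g n) @ \oo --> a * b.
Proof. by move=> h1 h2; exact: cvgM. Qed.

Lemma rcvg_cst (a : R) : (fun _ : nat => a) @ \oo --> a.
Proof. exact: cvg_cst. Qed.

Lemma eq_cvg_seq (f g : nat -> R) (l : R) : f =1 g -> f @ \oo --> l -> g @ \oo --> l.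
Proof. by move=> /funext ->. Qed.

(** Convergence of a sequence of complex numbers, expressed by the real and the
    imaginary parts.  It implies convergence for the norm topology ([cvgC_lim]). *)
Definition cvgC u (l : C) : Prop :=
  ((fun n => complex.Re (u n)) @ \oo --> complex.Re l) /\
  ((fun n => complex.Im (u n)) @ \oo --> complex.Im l).

Lemma cvgC_normc u l : cvgC u l -> (fun n => normc (u n - l)) @ \oo --> (0 : R).
Proof.
move=> [h1 h2].
have h1' : (fun n => `|complex.Re (u n) - complex.Re l|) @ \oo --> (0 : R).
  rewrite -[0](normr0 R) -[X in `|X|](subrr (complex.Re l)).
  by apply: cvg_norm; apply: rcvgB => //; exact: cvg_cst.
have h2' : (fun n => `|complex.Im (u n) - complex.Im l|) @ \oo --> (0 : R).
  rewrite -[0](normr0 R) -[X in `|X|](subrr (complex.Im l)).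
  by apply: cvg_norm; apply: rcvgB => //; exact: cvg_cst.
have h3 : (fun n => `|complex.Re (u n) - complex.Re l| +
    `|complex.Im (u n) - complex.Im l|) @ \oo --> (0 : R).
  by rewrite -[0]addr0; exact: rcvgD h1' h2'.
apply: (squeeze_cvgr _ _ h3); last exact: cvg_cst.
near=> n; rewrite normc_ge0 /=.
by apply: le_trans (normc_le_ReIm _) _; rewrite cReB cImB.
Unshelve. all: by end_near. Qed.

Lemma cvgC_squeeze u l (v : nat -> R) :
  (forall n, normc (u n - l) <= v n) -> v @ \oo --> (0 : R) -> cvgC u l.
Proof.
move=> uv v0; split.
- have h : (fun n => complex.Re (u n) - complex.Re l) @ \oo --> (0 : R).
    apply: (@squeeze_cvgr _ _ _ _ (fun n => - v n) _ _ _ _ _ v0); last first.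
      by rewrite -[0]oppr0; apply: cvgN; exact: v0.
    near=> n; rewrite -ler_norml.
    by apply: (le_trans _ (uv n)); rewrite -cReB; exact: Re_le_normc.
  have := rcvgD h (@rcvg_cst (complex.Re l)); rewrite add0r.
  by move=> H; refine (eq_cvg_seq _ H) => n; rewrite /= subrK.
- have h : (fun n => complex.Im (u n) - complex.Im l) @ \oo --> (0 : R).
    apply: (@squeeze_cvgr _ _ _ _ (fun n => - v n) _ _ _ _ _ v0); last first.
      by rewrite -[0]oppr0; apply: cvgN; exact: v0.
    near=> n; rewrite -ler_norml.
    by apply: (le_trans _ (uv n)); rewrite -cImB; exact: Im_le_normc.
  have := rcvgD h (@rcvg_cst (complex.Im l)); rewrite add0r.
  by move=> H; refine (eq_cvg_seq _ H) => n; rewrite /= subrK.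
Unshelve. all: by end_near. Qed.

Lemma cvgC_lim u l : cvgC u l -> lim ((u : nat -> C^o) @ \oo) = l.
Proof.
move=> h; apply: (@cvg_lim _ (@norm_hausdorff _ _)).
apply/cvgrPdist_lt => e e0.
have e0' : 0 < complex.Re e by move: e0; rewrite ltcE => /andP[].
have /cvgrPdist_lt /(_ _ e0') := cvgC_normc h.
apply: filterS => n; rewrite sub0r normrN ger0_norm ?normc_ge0 // => hn.
rewrite distrC normCE ltcE /= hn andbT.
by move: e0; rewrite ltcE => /andP[].
Qed.

Lemma cvgC_unique u l l' : cvgC u l -> cvgC u l' -> l = l'.
Proof. by move=> /cvgC_lim <- /cvgC_lim. Qed.

Lemma cvgC_cst c : cvgC (fun=> c) c.
Proof. by split; exact: cvg_cst. Qed.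

Lemma cvgC_eq u v l : u =1 v -> cvgC u l -> cvgC v l.
Proof. by move=> /funext ->. Qed.

Lemma cvgC_near u v l N0 : (forall n, (N0 <= n)%N -> u n = v n) -> cvgC u l -> cvgC v l.
Proof.
move=> uv [h1 h2]; split.
- rewrite -(cvg_shiftn N0); rewrite -(cvg_shiftn N0) in h1.
  by refine (eq_cvg_seq _ h1) => n /=; rewrite uv // leq_addl.
- rewrite -(cvg_shiftn N0); rewrite -(cvg_shiftn N0) in h2.
  by refine (eq_cvg_seq _ h2) => n /=; rewrite uv // leq_addl.
Qed.

Lemma cvgC_eqS u v l : (forall n, u n.+1 = v n.+1) -> cvgC u l -> cvgC v l.
Proof. by move=> uv; apply: (@cvgC_near _ _ _ 1) => -[]. Qed.

Lemma cvgCD u v l l' : cvgC u l -> cvgC v l' -> cvgC (fun n => u n + v n) (l + l').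
Proof.
move=> [h1 h2] [h3 h4]; split.
  by have := rcvgD h1 h3; rewrite -cReD; move=> H; refine (eq_cvg_seq _ H) => n; rewrite /= cReD.
by have := rcvgD h2 h4; rewrite -cImD; move=> H; refine (eq_cvg_seq _ H) => n; rewrite /= cImD.
Qed.

Lemma cReM x y : complex.Re (x * y) =
  complex.Re x * complex.Re y - complex.Im x * complex.Im y.
Proof. by case: x y => [a b] [c d]. Qed.

Lemma cImM x y : complex.Im (x * y) =
  complex.Re x * complex.Im y + complex.Im x * complex.Re y.
Proof. by case: x y => [a b] [c d]. Qed.

Lemma cvgCM u v l l' : cvgC u l -> cvgC v l' -> cvgC (fun n => u n * v n) (l * l').
Proof.
move=> [h1 h2] [h3 h4]; split.
  rewrite cReM; refine (eq_cvg_seq _ (rcvgB (rcvgM h1 h3) (rcvgM h2 h4))) => n.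
  by rewrite cReM.
rewrite cImM; refine (eq_cvg_seq _ (rcvgD (rcvgM h1 h4) (rcvgM h2 h3))) => n.
by rewrite cImM.
Qed.

Lemma cvgCN u l : cvgC u l -> cvgC (fun n => - u n) (- l).
Proof.
move=> h; rewrite -mulN1r; apply: cvgC_eq (cvgCM (cvgC_cst (-1)) h) => n /=.
by rewrite mulN1r.
Qed.

Lemma cvgCB u v l l' : cvgC u l -> cvgC v l' -> cvgC (fun n => u n - v n) (l - l').
Proof. by move=> h1 h2; exact: cvgCD h1 (cvgCN h2). Qed.

Lemma cvgC_reindex u l (f : nat -> nat) :
  (forall M, exists N, forall n, (N <= n)%N -> (M <= f n)%N) ->
  cvgC u l -> cvgC (u \o f) l.
Proof.
move=> nf [h1 h2].
have ff : f @ \oo --> \oo.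
  move=> A [M _ MA]; have [N Nf] := nf M.
  by exists N => // n /= Nn; apply: MA => /=; exact: Nf.
by split; [exact: (cvg_comp _ _ ff h1)|exact: (cvg_comp _ _ ff h2)].
Qed.

Lemma cvgC_normc_le u l M : cvgC u l -> (forall n, normc (u n) <= M) -> normc l <= M.
Proof.
move=> h uM.
have h0 := rcvgD (cvgC_normc h) (@rcvg_cst M); rewrite add0r in h0.
apply: (cvgr_to_ge h0); near=> n => /=.
have := normc_le0D (- (u n - l)) (u n); rewrite normc_opp.
have -> : - (u n - l) + u n = l by ring.
by move=> /le_trans; apply; rewrite lerD2l.
Unshelve. all: by end_near. Qed.

(** A sequence whose increments are dominated by those of a bounded real
    sequence v converges. *)
Lemma cvgC_cauchy u (v : nat -> R) (A : R) :
  (forall m n, (m <= n)%N -> normc (u n - u m) <= v n - v m) ->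
  (forall n, v n <= A) -> exists l, cvgC u l.
Proof.
move=> uv vA.
have nd : nondecreasing_seq v.
  by move=> m n mn; rewrite -subr_ge0 (le_trans (normc_ge0 _) (uv _ _ mn)).
have cv : cvgn v.
  by apply: nondecreasing_is_cvgn => //; exists A => _ [n _ <-].
(* Both v and v + w are nondecreasing and bounded, so w is a difference of
   convergent sequences. *)
have key (w : nat -> R) :
    (forall m n, (m <= n)%N -> `|w n - w m| <= v n - v m) -> exists l : R, w @ \oo --> l.
  move=> wv.
  have nd2 : nondecreasing_seq (fun n => v n + w n).
    move=> m n mn; have := wv _ _ mn; rewrite ler_norml => /andP[h _].
    by move: h; lra.
  have cvw : cvgn (fun n => v n + w n).
    apply: nondecreasing_is_cvgn => //; exists (A + (w 0%N + (A - v 0%N))) => _ [n _ <-].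
    have := wv _ _ (leq0n n); rewrite ler_norml => /andP[_ h].
    by move: h (vA n); lra.
  exists (limn (fun n => v n + w n) - limn v).
  refine (eq_cvg_seq _ (rcvgB cvw cv)) => n /=.
  by rewrite addrC addKr.
have [a ha] : exists l : R, (fun n => complex.Re (u n)) @ \oo --> l.
  apply: key => m n mn; rewrite -raddfB.
  exact: le_trans (Re_le_normc _) (uv _ _ mn).
have [b hb] : exists l : R, (fun n => complex.Im (u n)) @ \oo --> l.
  apply: key => m n mn; rewrite -raddfB.
  exact: le_trans (Im_le_normc _) (uv _ _ mn).
by exists (a +i* b).
Qed.

Lemma prod1D_le_expR (I : Type) (s : seq I) (a : I -> R) : (forall i, 0 <= a i) ->
  \prod_(i <- s) (1 + a i) <= expR (\sum_(i <- s) a i).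
Proof.
move=> a0; elim: s => [|i s IH]; first by rewrite !big_nil expR0.
rewrite !big_cons expRD ler_pM ?expR_ge1Dx ?addr_ge0 //.
by apply: prodr_ge0 => j _; rewrite addr_ge0.
Qed.

Lemma normc_prod1D (I : Type) (s : seq I) (u : I -> C) (a : I -> R) :
  (forall i, normc (u i) <= a i) ->
  normc (\prod_(i <- s) (1 + u i)) <= \prod_(i <- s) (1 + a i).
Proof.
move=> ua; rewrite normc_prod; apply: ler_prod => i _.
rewrite normc_ge0 /=; apply: le_trans (normc_le0D _ _) _.
by rewrite normc1 lerD2l.
Qed.

Lemma normc_prod1D_sub1 (I : Type) (s : seq I) (u : I -> C) (a : I -> R) :
  (forall i, normc (u i) <= a i) ->
  normc (\prod_(i <- s) (1 + u i) - 1) <= \prod_(i <- s) (1 + a i) - 1.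
Proof.
move=> ua; elim: s => [|i s IH]; first by rewrite !big_nil subrr normc0 subrr.
rewrite !big_cons.
set P := \prod_(j <- s) _ in IH *; set Q := \prod_(j <- s) _ in IH *.
have -> : (1 + u i) * P - 1 = P - 1 + u i * P by ring.
have -> : (1 + a i) * Q - 1 = Q - 1 + a i * Q by ring.
apply: le_trans (normc_le0D _ _) _; apply: lerD => //.
rewrite normcM ler_pM ?normc_ge0 //.
exact: normc_prod1D.
Qed.

(** Convergence of the product of the 1 + u i along an increasing sequence of
    finite index sets, when u is dominated by a summable family a.  The factors are
    allowed to vanish. *)
Lemma cvgC_prod (I : eqType) (s : nat -> seq I) (u : I -> C) (a : I -> R) (A : R) :
  (forall n, uniq (s n)) ->
  (forall m n, (m <= n)%N -> {subset s m <= s n}) ->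
  (forall i, normc (u i) <= a i) ->
  (forall n, \sum_(i <- s n) a i <= A) ->
  exists2 l, cvgC (fun n => \prod_(i <- s n) (1 + u i)) l & normc l <= expR A /\
    forall n, normc (\prod_(i <- s n) (1 + u i)) <= expR A.
Proof.
move=> us ss ua sA.
have a0 i : 0 <= a i by exact: le_trans (normc_ge0 _) (ua i).
have vA n : \prod_(i <- s n) (1 + a i) <= expR A.
  apply: le_trans (prod1D_le_expR _ a0) _; by rewrite ler_expR.
have [|l hl] := @cvgC_cauchy (fun n => \prod_(i <- s n) (1 + u i))
  (fun n => \prod_(i <- s n) (1 + a i)) (expR A) _ vA.
  move=> m n mn.
  (* The increment of the product from m to n is the product over s m times
       (the product over the new indices minus 1). *)
  pose r := [seq i <- s n | i \notin s m].
  have pe : perm_eq (s n) (s m ++ r).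
    apply: uniq_perm => //.
      rewrite cat_uniq us filter_uniq // andbT /=; apply/hasPn => i.
      by rewrite mem_filter => /andP[].
    move=> i; rewrite mem_cat mem_filter; case: (boolP (i \in s m)) => //= im.
    exact: ss im.
  rewrite !(perm_big _ pe) /= !big_cat /=.
  set P := \prod_(i <- s m) (1 + u i); set Q := \prod_(i <- s m) (1 + a i).
  rewrite -[X in _ * _ - X]mulr1 -mulrBr -[X in _ <= _ * _ - X]mulr1 -mulrBr normcM.
  rewrite ler_pM ?normc_ge0 //; first exact: normc_prod1D.
  exact: normc_prod1D_sub1.
have bnd n : normc (\prod_(i <- s n) (1 + u i)) <= expR A.
  exact: le_trans (normc_prod1D _ ua) (vA n).
by exists l => //; split => //; exact: cvgC_normc_le hl bnd.
Qed.

End ComplexLimits.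

(** * The reflection formula of the elliptic gamma function *)

Section GammaReflection.
Context {R : realType}.
Local Notation C := R[i].
Implicit Types (p q x z : C).

Lemma geo_sum_le (r : R) n : 0 <= r < 1 ->
  \sum_(k <- index_iota 0 n) r ^+ k <= (1 - r)^-1.
Proof.
move=> /andP[r0 r1]; have r1' : 0 < 1 - r by rewrite subr_gt0.
rewrite -[leRHS]mul1r ler_pdivlMr // big_mkord mulrC.
have -> : (1 - r) * (\sum_(i < n) r ^+ i) = 1 - r ^+ n.
  by rewrite -opprB mulNr -subrX1 opprB.
by rewrite gerBl exprn_ge0.
Qed.

Lemma qpoch_cvg p z : normc p < 1 ->
  cvgC (fun N => \prod_(0 <= k < N) (1 - z * p ^+ k)) (qpoch z p) /\
  normc (qpoch z p) <= expR (normc z / (1 - normc p)).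
Proof.
move=> p1.
have [||||l hl [lb _]] := @cvgC_prod R nat (index_iota 0) (fun k => - (z * p ^+ k))
  (fun k => normc z * normc p ^+ k) (normc z / (1 - normc p)).
- by move=> n; exact: iota_uniq.
- by move=> m n mn k; rewrite !mem_index_iota => /andP[-> /leq_trans]; exact.
- by move=> k; rewrite normc_opp normcM normcX.
- move=> n; rewrite -mulr_sumr ler_wpM2l ?normc_ge0 // geo_sum_le //.
  by rewrite normc_ge0.
by rewrite (_ : qpoch z p = l) //; exact: cvgC_lim hl.
Qed.

(** The square partial products that define the elliptic gamma function. *)
Definition gamma_trunc p q z N : C :=
  \prod_(0 <= j < N) \prod_(0 <= k < N)
      ((1 - z^-1 * p ^+ j.+1 * q ^+ k.+1) / (1 - z * p ^+ j * q ^+ k)).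

(** The partial products converge as soon as the denominators stay away from 0:
    each factor is 1 + u with |u| bounded by a multiple of |p|^j |q|^k. *)
Lemma egamma_cvg p q z (d : R) : normc p < 1 -> normc q < 1 -> 0 < d ->
  (forall j k, d <= normc (1 - z * p ^+ j * q ^+ k)) ->
  cvgC (gamma_trunc p q z) (egamma p q z) /\
  normc (egamma p q z) <=
    expR ((normc z + normc z^-1) / d * ((1 - normc p)^-1 * (1 - normc q)^-1)).
Proof.
move=> p1 q1 d0 dP.
pose s N := [seq (j, k) | j <- index_iota 0 N, k <- index_iota 0 N].
pose u (i : nat * nat) := (1 - z^-1 * p ^+ i.1.+1 * q ^+ i.2.+1) /
   (1 - z * p ^+ i.1 * q ^+ i.2) - 1.
have [||||l hl [lb _]] := @cvgC_prod R (nat * nat)%type s u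
  (fun i => (normc z + normc z^-1) / d * (normc p ^+ i.1 * normc q ^+ i.2))
  ((normc z + normc z^-1) / d * ((1 - normc p)^-1 * (1 - normc q)^-1)).
- move=> n; apply: allpairs_uniq; try exact: iota_uniq.
  by move=> [? ?] [? ?].
- move=> m n mn [j k] /allpairsP[[j' k'] /= [hj hk [-> ->]]].
  apply/allpairsP; exists (j', k'); split => //=;
  by [move: hj; rewrite !mem_index_iota => /andP[-> /leq_trans]; exact
     |move: hk; rewrite !mem_index_iota => /andP[-> /leq_trans]; exact].
- move=> [j k]; rewrite /u /=.
  set B := 1 - z * _ * _; set A := 1 - z^-1 * _ * _.
  have B0 : B != 0.
    apply/eqP => B0; have := dP j k; rewrite -/B B0 normc0.
    by rewrite leNgt d0.
  have -> : A / B - 1 = (A - B) / B by field.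
  rewrite normcM normcV mulrAC ler_pM ?invr_ge0 ?normc_ge0 //; last first.
    by rewrite lef_pV2 ?posrE ?dP ?(lt_le_trans d0 (dP j k)).
  have -> : A - B = (z - z^-1 * p * q) * (p ^+ j * q ^+ k).
    by rewrite /A /B !exprS; ring.
  rewrite normcM ler_pM ?normc_ge0 //; last by rewrite normcM !normcX.
  apply: le_trans (normc_le0D _ _) _; rewrite lerD2l normc_opp !normcM.
  rewrite -mulrA ler_piMr ?normc_ge0 //.
  by rewrite mulr_ile1 ?normc_ge0 // ltW.
- move=> n; rewrite -mulr_sumr ler_wpM2l //.
    by rewrite divr_ge0 ?addr_ge0 ?normc_ge0 // ltW.
  rewrite big_allpairs /=.
  under eq_bigr do rewrite -mulr_sumr.
  rewrite -mulr_suml ler_pM ?geo_sum_le ?normc_ge0 //; 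
    by apply: sumr_ge0 => i _; rewrite exprn_ge0 ?normc_ge0.
have hl' : cvgC (gamma_trunc p q z) l.
  apply: cvgC_eq hl => n; rewrite big_allpairs /=.
  by apply: eq_bigr => j _; apply: eq_bigr => k _; rewrite /u /= addrC subrK.
by rewrite (_ : egamma p q z = l) //; exact: cvgC_lim hl'.
Qed.

(** The products along the far sides of the square index set tend to 1. *)
Lemma qpoch_tail x p q : normc p < 1 -> normc q < 1 ->
  cvgC (fun N => \prod_(0 <= k < N) (1 - x * q ^+ N * p ^+ k)) 1.
Proof.
move=> p1 q1.
apply: (@cvgC_squeeze _ _ _ (fun N => expR (normc x / (1 - normc p) * normc q ^+ N) - 1)).
  move=> N.
  have := @normc_prod1D_sub1 R nat (index_iota 0 N) (fun k => - (x * q ^+ N * p ^+ k))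
     (fun k => normc x * normc q ^+ N * normc p ^+ k).
  move=> /(_ _)/le_trans; apply.
    by move=> k; rewrite normc_opp !normcM !normcX.
  rewrite lerD2r; apply: le_trans (prod1D_le_expR _ _) _.
    by move=> k; rewrite !mulr_ge0 ?exprn_ge0 ?normc_ge0.
  rewrite ler_expR -mulr_sumr [leRHS]mulrAC ler_wpM2l //.
    by rewrite mulr_ge0 ?exprn_ge0 ?normc_ge0.
  by rewrite geo_sum_le // normc_ge0.
rewrite -(subrr (1 : R)); apply: rcvgB; last exact: rcvg_cst.
rewrite -[X in _ --> X]expR0.
have h : (fun N => normc x / (1 - normc p) * normc q ^+ N) @ \oo --> (0 : R).
  rewrite -(mulr0 (normc x / (1 - normc p))); apply: rcvgM; first exact: rcvg_cst.
  by apply: cvg_expr; rewrite ger0_norm ?normc_ge0.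
exact: (cvg_comp _ _ h (@continuous_expR R 0)).
Qed.

Lemma prod_shift (f : nat -> C) N :
  (\prod_(0 <= j < N) f j.+1) * f 0%N = (\prod_(0 <= j < N) f j) * f N.
Proof.
by rewrite mulrC -big_nat_recl // -big_nat_recr.
Qed.

(** Shifting both indices of a double product over a square only changes its
    four sides. *)
Lemma prod_shift2 (D : nat -> nat -> C) N :
  (\prod_(0 <= j < N) \prod_(0 <= k < N) D j.+1 k.+1) *
    ((\prod_(0 <= k < N) D 0%N k.+1) * (\prod_(0 <= j < N) D j 0%N)) =
  (\prod_(0 <= j < N) \prod_(0 <= k < N) D j k) *
    ((\prod_(0 <= j < N) D j N) * (\prod_(0 <= k < N) D N k.+1)).
Proof.
rewrite mulrA (prod_shift (fun j => \prod_(0 <= k < N) D j k.+1)).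
rewrite mulrAC -big_split /= mulrA; congr (_ * _).
by rewrite -big_split; apply: eq_bigr => j _ /=; rewrite prod_shift.
Qed.

(** The reflection formula away from the poles.  The partial products of
    Gamma(x) Gamma(1/x) telescope: the two near sides of each square produce the
    four q-Pochhammer symbols of the theta functions, the two far sides tend to 1. *)
Lemma egamma_reflect_ne1 p q x : normc p < 1 -> normc q < 1 -> normc x = 1 -> x != 1 ->
  egamma p q x * egamma p q x^-1 * (theta p x * theta q x^-1) = 1.
Proof.
move=> p1 q1 x1 xn1.
have p0 := normc_ge0 p; have q0 := normc_ge0 q.
have x0 : x != 0 by apply/eqP => x0; move: x1; rewrite x0 normc0 => /eqP; rewrite eq_sym oner_eq0.
have y1 : normc x^-1 = 1 by rewrite normcV x1 invr1.
(* The denominators of the gamma products are bounded away from 0. *)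
have lower z : normc z = 1 -> z != 1 ->
    exists2 d : R, 0 < d & forall j k, d <= normc (1 - z * p ^+ j * q ^+ k).
  move=> z1 zn1.
  have n1 : 0 < normc (1 - z).
    rewrite lt_neqAle normc_ge0 andbT eq_sym; apply/eqP => /eq0_normc /eqP.
    by rewrite subr_eq0 eq_sym (negPf zn1).
  exists (Num.min (normc (1 - z)) (Num.min (1 - normc p) (1 - normc q))).
    by rewrite !lt_min n1 !subr_gt0 p1 q1.
  move=> j k; rewrite !ge_min.
  have tri (w : C) : 1 - normc w <= normc (1 - w).
    have := normc_le0D (1 - w) w; rewrite subrK normc1 => h; by rewrite lerBlDr.
  case: j k => [|j] [|k]; first by rewrite !expr0 !mulr1 lexx.
  - apply/orP; right; apply/orP; right; apply: le_trans (tri _).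
    rewrite lerD2l lerN2 !normcM z1 !normcX expr0 !mul1r exprS.
    by rewrite ler_piMr // exprn_ile1 // ltW.
  - apply/orP; right; apply/orP; left; apply: le_trans (tri _).
    rewrite lerD2l lerN2 !normcM z1 !normcX expr0 mul1r mulr1 exprS.
    by rewrite ler_piMr // exprn_ile1 // ltW.
  - apply/orP; right; apply/orP; left; apply: le_trans (tri _).
    rewrite lerD2l lerN2 !normcM z1 !normcX mul1r exprS -mulrA.
    by rewrite ler_piMr // mulr_ile1 ?exprn_ge0 // exprn_ile1 // ltW.
have [d d0 dP] := lower x x1 xn1.
have yn1 : x^-1 != 1 by rewrite invr_eq1.
have [e e0 eP] := lower _ y1 yn1.
have [gx _] := egamma_cvg p1 q1 d0 dP.
have [gy _] := egamma_cvg p1 q1 e0 eP.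
have [q1x _] := qpoch_cvg (x * q) q1.
have [q2x _] := qpoch_cvg x p1.
have [q1y _] := qpoch_cvg (x^-1 * p) p1.
have [q2y _] := qpoch_cvg x^-1 q1.
have t1 := qpoch_tail x p1 q1.
have t2 := qpoch_tail (x * q) q1 p1.
have t3 := qpoch_tail x^-1 q1 p1.
have t4 := qpoch_tail (x^-1 * p) p1 q1.
have -> : egamma p q x * egamma p q x^-1 * (theta p x * theta q x^-1) =
  egamma p q x * egamma p q x^-1 * ((qpoch (x * q) q * qpoch x p) *
    (qpoch (x^-1 * p) p * qpoch x^-1 q)).
  rewrite /theta invrK (mulrC p) (mulrC q); congr (_ * _).
  by rewrite [X in _ * X = _]mulrC mulrACA [X in X * _ = _]mulrC.
have h1 := cvgCM (cvgCM gx gy) (cvgCM (cvgCM q1x q2x) (cvgCM q1y q2y)).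
have h2 := cvgCM (cvgCM t1 t2) (cvgCM t3 t4).
rewrite !mulr1 in h2.
apply: cvgC_unique h1 _; apply: cvgC_eq h2 => N.
rewrite /gamma_trunc invrK.
pose Dx j k := 1 - x * p ^+ j * q ^+ k.
pose Dy j k := 1 - x^-1 * p ^+ j * q ^+ k.
have Dx0 j k : Dx j k != 0.
  by apply/eqP => h; have := dP j k; rewrite -/(Dx j k) h normc0 leNgt d0.
have Dy0 j k : Dy j k != 0.
  by apply/eqP => h; have := eP j k; rewrite -/(Dy j k) h normc0 leNgt e0.
have B0 : \prod_(0 <= j < N) \prod_(0 <= k < N) Dy j k != 0.
  rewrite prodf_seq_neq0; apply/allP => j _ /=.
  by rewrite prodf_seq_neq0; apply/allP => k _ /=.
have B0' : \prod_(0 <= j < N) \prod_(0 <= k < N) Dx j k != 0.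
  rewrite prodf_seq_neq0; apply/allP => j _ /=.
  by rewrite prodf_seq_neq0; apply/allP => k _ /=.
(* For 1/x the roles of p and q are exchanged, so that the sides pair up as
   (x; p) (p/x; p) and (1/x; q) (q x; q). *)
have H1 := prod_shift2 Dx N; have H2 := prod_shift2 (fun k j => Dy j k) N.
rewrite exchange_big [in RHS]exchange_big /= in H2.
have -> : \prod_(0 <= j < N) \prod_(0 <= k < N)
   ((1 - x^-1 * p ^+ j.+1 * q ^+ k.+1) / (1 - x * p ^+ j * q ^+ k)) =
  (\prod_(0 <= j < N) \prod_(0 <= k < N) Dy j.+1 k.+1) /
  (\prod_(0 <= j < N) \prod_(0 <= k < N) Dx j k).
  by rewrite -prodf_div; apply: eq_bigr => j _; rewrite -prodf_div.
have -> : \prod_(0 <= j < N) \prod_(0 <= k < N)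
   ((1 - x * p ^+ j.+1 * q ^+ k.+1) / (1 - x^-1 * p ^+ j * q ^+ k)) =
  (\prod_(0 <= j < N) \prod_(0 <= k < N) Dx j.+1 k.+1) /
  (\prod_(0 <= j < N) \prod_(0 <= k < N) Dy j k).
  by rewrite -prodf_div; apply: eq_bigr => j _; rewrite -prodf_div.
have -> : \prod_(0 <= k < N) (1 - x * q * q ^+ k) = \prod_(0 <= k < N) Dx 0%N k.+1.
  by apply: eq_bigr => k _; rewrite /Dx !exprS; ring.
have -> : \prod_(0 <= k < N) (1 - x * p ^+ k) = \prod_(0 <= k < N) Dx k 0%N.
  by apply: eq_bigr => k _; rewrite /Dx; ring.
have -> : \prod_(0 <= k < N) (1 - x^-1 * p * p ^+ k) = \prod_(0 <= k < N) Dy k.+1 0%N.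
  by apply: eq_bigr => k _; rewrite /Dy !exprS; ring.
have -> : \prod_(0 <= k < N) (1 - x^-1 * q ^+ k) = \prod_(0 <= k < N) Dy 0%N k.
  by apply: eq_bigr => k _; rewrite /Dy; ring.
have -> : \prod_(0 <= k < N) (1 - x * q ^+ N * p ^+ k) = \prod_(0 <= k < N) Dx k N.
  by apply: eq_bigr => k _; rewrite /Dx; ring.
have -> : \prod_(0 <= k < N) (1 - x * q * p ^+ N * q ^+ k) = \prod_(0 <= k < N) Dx N k.+1.
  by apply: eq_bigr => k _; rewrite /Dx !exprS; ring.
have -> : \prod_(0 <= k < N) (1 - x^-1 * p ^+ N * q ^+ k) = \prod_(0 <= k < N) Dy N k.
  by apply: eq_bigr => k _; rewrite /Dy; ring.
have -> : \prod_(0 <= k < N) (1 - x^-1 * p * q ^+ N * p ^+ k) =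
   \prod_(0 <= k < N) Dy k.+1 N.
  by apply: eq_bigr => k _; rewrite /Dy !exprS; ring.
set A := (X in X * _ = _) in H2; set Q := (X in _ * X = _) in H2.
set A' := (X in X * _ = _) in H1; set Q' := (X in _ * X = _) in H1.
set B := \prod_(0 <= j < N) \prod_(0 <= k < N) Dy j k in B0 H2 *.
set B' := \prod_(0 <= j < N) \prod_(0 <= k < N) Dx j k in B0' H1 *.
set E := (X in _ = _ * X) in H2; set E' := (X in _ = _ * X) in H1.
have -> : A / B' * (A' / B) * (Q' * Q) = (A' * Q') * (A * Q) / (B' * B).
  by field; rewrite B0 B0'.
rewrite H1 H2 /E /E' /=; field; by rewrite B0 B0'.
Qed.

(** On the unit circle the only pole of Gamma is x = 1.  There the value of
    [egamma] is 0, so its inverse is 0, as is theta_p(1). *)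
Lemma egamma_reflect p q x : normc p < 1 -> normc q < 1 -> normc x = 1 ->
  (egamma p q x * egamma p q x^-1)^-1 = theta p x * theta q x^-1.
Proof.
move=> p1 q1 x1; have [x_eq1|xn1] := eqVneq x 1; last first.
  have h := egamma_reflect_ne1 p1 q1 x1 xn1.
  set g := egamma p q x * _ in h *.
  have g0 : g != 0 by apply/eqP => g0; move: h; rewrite g0 mul0r => /eqP; rewrite eq_sym oner_eq0.
  by apply: (mulfI g0); rewrite h divff.
have -> : egamma p q x = 0.
  apply: cvgC_lim; apply: cvgC_eqS (cvgC_cst 0) => N.
  rewrite big_nat_recl // [X in X * _]big_nat_recl // x_eq1.
  by rewrite !expr0 !mulr1 subrr invr0 mulr0 !mul0r.
have -> : theta p x = 0.
  rewrite /theta; have -> : qpoch x p = 0; last by rewrite mul0r.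
  apply: cvgC_lim; apply: cvgC_eqS (cvgC_cst 0) => N.
  by rewrite big_nat_recl // x_eq1 expr0 mulr1 subrr mul0r.
by rewrite !mul0r invr0.
Qed.

End GammaReflection.

(** * Dominated convergence for finite sums *)

Section Tannery.
Context {R : realType}.
Local Notation C := R[i].

Lemma ler_sum_sub (I : eqType) (s t : seq I) (b : I -> R) :
  uniq s -> uniq t -> {subset s <= t} -> (forall i, 0 <= b i) ->
  \sum_(i <- s) b i <= \sum_(i <- t) b i.
Proof.
move=> us ut st b0.
rewrite [leRHS](bigID (fun i => i \in s)) /= -[X in _ <= X + _]big_filter.
have pe : perm_eq s [seq i <- t | i \in s].
  apply: uniq_perm => //; first exact: filter_uniq.
  by move=> i; rewrite mem_filter; case: (boolP (i \in s)) => //= /st ->.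
by rewrite (perm_big _ pe) lerDl; apply: sumr_ge0.
Qed.

Lemma cvgC_eps (u : nat -> C) l :
  (forall e : R, 0 < e -> exists2 v : nat -> R, v @ \oo --> (0 : R) &
     forall n, normc (u n - l) <= v n + e) -> cvgC u l.
Proof.
move=> h; apply: (cvgC_squeeze (v := fun n => normc (u n - l))) => //.
apply/cvgrPdist_le => e e0.
have e2 : 0 < e / 2 by rewrite divr_gt0.
have [v v0 uv] := h _ e2.
have /cvgrPdist_le /(_ _ e2) := v0.
apply: filterS => n; rewrite !sub0r !normrN (ger0_norm (normc_ge0 _)) => vn.
apply: le_trans (uv n) _; have := ler_norm (v n); move: vn; lra.
Qed.

Lemma rcvg_sum0 (I : Type) (s : seq I) (f : I -> nat -> R) :
  (forall i, f i @ \oo --> (0 : R)) ->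
  (fun n => \sum_(i <- s) f i n) @ \oo --> (0 : R).
Proof.
move=> h; elim: s => [|i s IH].
  by refine (eq_cvg_seq _ (@rcvg_cst R 0)) => n; rewrite big_nil.
have := rcvgD (h i) IH; rewrite addr0 => H.
by refine (eq_cvg_seq _ H) => n; rewrite big_cons.
Qed.

(** Tannery's theorem: bounded weights that tend to 0 pointwise give weighted
    finite sums of a summable family that tend to 0. *)
Lemma tannery (I : eqType) (a : I -> C) (A K : R) (s : nat -> seq I)
  (w : nat -> I -> C) : 0 < K ->
  (forall t, uniq t -> \sum_(i <- t) normc (a i) <= A) ->
  (forall n, uniq (s n)) ->
  (forall n i, normc (w n i) <= K) ->
  (forall i, cvgC (w ^~ i) 0) ->
  cvgC (fun n => \sum_(i <- s n) w n i * a i) 0.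
Proof.
move=> K0 hA us wK w0; apply: cvgC_eps => e e0.
(* A finite set t whose partial sum is within e / K of the supremum controls
   the contribution of all indices outside t. *)
pose E : set R := [set x | exists2 t, uniq t & x = \sum_(i <- t) normc (a i)].
have supE : has_sup E.
  split; first by exists 0, [::] => //; rewrite big_nil.
  by exists A => _ [t ut ->]; exact: hA.
have eK0 : 0 < e / K by rewrite divr_gt0.
have [_ [t ut ->] lt_t] := sup_adherent eK0 supE.
exists (fun n => \sum_(i <- t) normc (w n i * a i)).
  apply: rcvg_sum0 => i.
  have := cvgC_normc (cvgCM (w0 i) (cvgC_cst (a i))); rewrite mul0r => h.
  by refine (eq_cvg_seq _ h) => n; rewrite subr0.
move=> n; rewrite subr0; apply: le_trans (normc_sum _ _ _) _.
rewrite (bigID (fun i => i \in t)) /= -big_filter; apply: lerD.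
  apply: ler_sum_sub => //; first exact: filter_uniq.
    by move=> i; rewrite mem_filter => /andP[].
  by move=> i; exact: normc_ge0.
rewrite -big_filter; set r := [seq i <- s n | i \notin t].
apply: le_trans (_ : \sum_(i <- r) K * normc (a i) <= _).
  by apply: ler_sum => i _; rewrite normcM ler_wpM2r ?normc_ge0.
rewrite -mulr_sumr mulrC -ler_pdivlMr //.
have : E (\sum_(i <- t ++ r) normc (a i)).
  exists (t ++ r) => //; rewrite cat_uniq ut filter_uniq // andbT /=.
  by apply/hasPn => i; rewrite mem_filter => /andP[].
move=> /(ub_le_sup (proj2 supE)); rewrite big_cat /=.
by move: lt_t; lra.
Qed.

(** Two sequences of finite sums of the same summable family that exhaust it,
    the first one with bounded weights tending to c: the first sum is
    asymptotically c times the second. *)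
Lemma tannery_exhaust (I : eqType) (a : I -> C) (A K : R) (s s' : nat -> seq I)
  (w : nat -> I -> C) (c : C) : 0 < K ->
  (forall t, uniq t -> \sum_(i <- t) normc (a i) <= A) ->
  (forall n, uniq (s n)) -> (forall n, uniq (s' n)) ->
  (forall n i, i \in s n -> normc (w n i) <= K) ->
  (forall i, cvgC (fun n => if i \in s n then w n i else 0) c) ->
  (forall i, cvgC (fun n => if i \in s' n then c else 0) c) ->
  cvgC (fun n => \sum_(i <- s n) w n i * a i - c * \sum_(i <- s' n) a i) 0.
Proof.
move=> K0 hA us us' wK wc cc.
pose W n i := (if i \in s n then w n i else 0) - (if i \in s' n then c else 0).
have wK' n i : normc (W n i) <= K + normc c.
  rewrite /W; apply: le_trans (normc_le0D _ _) _; apply: lerD.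
    by case: ifP => [/wK //|_]; rewrite normc0 ltW.
  by rewrite normc_opp; case: ifP => //; rewrite normc0 normc_ge0.
have W0 i : cvgC (W ^~ i) 0.
  by rewrite -(subrr c); exact: cvgCB (wc i) (cc i).
have KK : 0 < K + normc c by rewrite ltr_wpDr ?normc_ge0.
have := tannery KK hA (fun n => undup_uniq (s n ++ s' n)) wK' W0.
apply: cvgC_eq => n.
have restrict (t : seq I) (f : I -> C) : uniq t -> {subset t <= s n ++ s' n} ->
    \sum_(i <- undup (s n ++ s' n)) (if i \in t then f i else 0) * a i =
    \sum_(i <- t) f i * a i.
  move=> ut st; under eq_bigr do rewrite (fun_if (fun x => x * _)) mul0r.
  rewrite -big_mkcond -big_filter; apply: perm_big; apply: uniq_perm => //.
    by rewrite filter_uniq // undup_uniq.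
  by move=> i; rewrite mem_filter mem_undup; case: (boolP (i \in t)) => //= /st ->.
rewrite /W; under eq_bigr do rewrite mulrBl.
rewrite sumrB !restrict ?mulr_sumr // => i; rewrite mem_cat => ->; rewrite ?orbT //.
Qed.

End Tannery.

(** * Truncated theta functions *)

Section TruncatedTheta.

Lemma int_parity (n : int) : exists m : int, n = 2 * m \/ n = 2 * m + 1.
Proof.
exists (n %/ 2)%Z; have := divz_eq n 2; have := modz_ge0 n (isT : (2 : int) != 0).
by have := ltz_pmod n (isT : (0 < 2 :> int)); lia.
Qed.

Variables (F : fieldType) (p : F).

(** The q-factorial (p; p)_M. *)
Definition qfact (M : nat) : F := \prod_(0 <= k < M) (1 - p ^+ k.+1).

(** The q-binomial coefficient; only the values with j <= M are meaningful. *)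
Definition qbin (M j : nat) : F := qfact M * (qfact j)^-1 * (qfact (M - j))^-1.

Hypothesis pX_neq1 : forall k, 1 - p ^+ k.+1 != 0.

Lemma qfact_neq0 M : qfact M != 0.
Proof.
by rewrite prodf_seq_neq0; apply/allP => j _ /=; rewrite pX_neq1.
Qed.

Lemma qfactS M : qfact M.+1 = qfact M * (1 - p ^+ M.+1).
Proof. by rewrite /qfact big_nat_recr. Qed.

Lemma qfact0 : qfact 0 = 1.
Proof. by rewrite /qfact big_nil. Qed.

Lemma qbin_pascal M j : (j < M)%N ->
  qbin M.+1 j.+1 = qbin M j.+1 + p ^+ (M - j) * qbin M j.
Proof.
move=> jM; rewrite /qbin subSS.
have -> : (M - j = (M - j.+1).+1)%N by lia.
set i := (M - j.+1)%N; have -> : M = (i + j).+1 by rewrite /i; lia.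
rewrite !qfactS; have := qfact_neq0 i; have := qfact_neq0 j.
have := pX_neq1 i; have := pX_neq1 j => h1 h2 h3 h4.
have e : p ^+ (i + j).+2 = p ^+ i.+1 * p ^+ j.+1.
  by rewrite -exprD; congr (_ ^+ _); lia.
rewrite e; field.
by rewrite h1 h2 h3 h4.
Qed.

Lemma qbin0 M : qbin M 0 = 1.
Proof. by rewrite /qbin subn0 qfact0 invr1 mulr1 divff // qfact_neq0. Qed.

Lemma qbinn M : qbin M M = 1.
Proof. by rewrite /qbin subnn qfact0 invr1 mulr1 divff // qfact_neq0. Qed.

Lemma qbinomial_thm M y :
  \prod_(0 <= k < M) (1 + y * p ^+ k) =
  \sum_(0 <= j < M.+1) qbin M j * (p ^+ 'C(j, 2) * y ^+ j).
Proof.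
elim: M => [|M IH]; first by rewrite big_nil big_nat1 qbin0 expr0 !mul1r.
rewrite big_nat_recr //= IH mulrDr mulr1.
have binS j : p ^+ 'C(j.+1, 2) = p ^+ 'C(j, 2) * p ^+ j.
  by rewrite binS bin1 exprD.
rewrite [in RHS]big_nat_recr //= [in RHS]big_nat_recl //=.
rewrite [X in X + _ = _]big_nat_recl //= [X in _ + X * _ = _]big_nat_recr //=.
rewrite !qbin0 !qbinn mulrDl mulr_suml -!addrA; congr (_ + _).
rewrite addrA -big_split /= binS exprS; congr (_ + _); last by ring.
apply: eq_big_nat => j /andP[_ jM].
rewrite qbin_pascal // mulrDl !binS !exprS; congr (_ + _).
by rewrite -[in p ^+ M](subnKC (ltnW jM)) exprD; ring.
Qed.

(** The exponent n (n - 1) / 2 for an integer n of any sign. *)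
Definition tri (n : int) : int := (n * (n - 1) %/ 2)%Z.

Lemma tri2 n : tri n * 2 = n * (n - 1).
Proof.
rewrite /tri divzK //.
have [m [->|->]] := int_parity n.
- by rewrite -mulrA dvdz_mulr.
- by rewrite addrK mulrCA dvdz_mulr.
Qed.

Lemma triS n : tri (n + 1) = tri n + n.
Proof. by have := tri2 n; have := tri2 (n + 1); nia. Qed.

Hypothesis p0 : p != 0.

(** The term (-1)^n p^(n (n - 1) / 2) z^n of the Laurent expansion of
    theta_p(z), up to a constant factor. *)
Definition theta_term (z : F) (n : int) : F := (-1) ^ n * p ^ tri n * z ^ n.

Lemma theta_term0 z : theta_term z 0 = 1.
Proof. by rewrite /theta_term (_ : tri 0 = 0) // !expr0z !mulr1. Qed.

Lemma theta_termS z n : z != 0 -> theta_term z (n + 1) = theta_term z n * (- z * p ^ n).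
Proof.
move=> z0; rewrite /theta_term triS !expfzDr ?oppr_eq0 ?oner_eq0 // !expr1z.
by ring.
Qed.

(** The finite form of the Jacobi triple product: the q-binomial theorem with
    2 N factors at y = - z p^(-N).  The index j stands for the exponent j - N. *)
Lemma theta_trunc_expand z N : z != 0 ->
  (\prod_(0 <= k < N) (1 - z * p ^+ k)) * (\prod_(0 <= k < N) (1 - p * z^-1 * p ^+ k)) =
  \sum_(0 <= j < (N + N).+1) qbin (N + N) j * theta_term z (j%:Z - N%:Z).
Proof.
move=> z0.
(* c collects the factors - z p^(-(i + 1)) taken out to turn the first N
   binomial factors into the 1 - p^(i + 1) / z. *)
pose c : F := \prod_(0 <= i < N) (- z * p ^ (- i.+1%:Z)).
have c0 : c != 0.
  rewrite prodf_seq_neq0; apply/allP => j _ /=.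
  by rewrite mulf_neq0 ?oppr_eq0 // expfz_neq0.
pose y := - z * p ^ (- N%:Z).
have t0 : theta_term z (- N%:Z) * c = 1.
  rewrite /c; elim: N {c c0 y} => [|N IH]; first by rewrite big_nil oppr0 theta_term0 mulr1.
  rewrite big_nat_recr //= -[RHS]IH.
  have -> : - N%:Z = - N.+1%:Z + 1 by lia.
  by rewrite theta_termS //; ring.
have tj j : p ^+ 'C(j, 2) * y ^+ j = theta_term z (j%:Z - N%:Z) * c.
  elim: j => [|j IH]; first by rewrite !expr0 mulr1 sub0r t0.
  have -> : j.+1%:Z - N%:Z = (j%:Z - N%:Z) + 1 by lia.
  rewrite theta_termS // mulrAC -IH binS bin1 exprD exprS.
  by rewrite expfzDr // /y -exprnP; ring.
apply: (mulIf c0); rewrite mulr_suml.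
under [RHS]eq_bigr do rewrite -mulrA -tj.
rewrite -qbinomial_thm [RHS](big_cat_nat (n := N)) ?leq_addr //=.
rewrite -mulrA mulrC; congr (_ * _); last first.
  rewrite -[in RHS](add0n N) big_addn addKn; apply: eq_bigr => k _.
  rewrite exprD /y; congr (1 + _).
  have h : p ^ (- N%:Z) * p ^+ N = 1 by rewrite exprnP -expfzDr // addNr expr0z.
  by rewrite -[LHS]mulr1 -h; ring.
rewrite /c -big_split /= [RHS]big_nat_rev /= add0n.
apply: eq_big_nat => k /andP[_ kN].
have e1 : p ^ (- N%:Z) * p ^+ (N - k.+1) = p ^ (- k.+1%:Z).
  by rewrite exprnP -expfzDr //; congr (_ ^ _); lia.
have e2 : p * p ^+ k * p ^ (- k.+1%:Z) = 1.
  by rewrite -exprS exprnP -expfzDr // addrN expr0z.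
rewrite [in RHS](_ : y * _ = - z * p ^ (- k.+1%:Z)); last by rewrite -e1 /y; ring.
rewrite mulrBl mul1r mulNr mulrN opprK addrC.
have -> : p / z * p ^+ k * (z * p ^ (- k.+1%:Z)) = p * p ^+ k * p ^ (- k.+1%:Z) by field.
by rewrite e2.
Qed.

(** In the product of the expansions at x z and x / z, the terms of exponents
    (m, n) with m + n even separate the variables x and z. *)
Lemma theta_term_even x z k l : x != 0 -> z != 0 ->
  theta_term (x * z) (k + l) * theta_term (x * z^-1) (k - l) =
  p ^ (k * k - k) * x ^ (2 * k) * (p ^ (l * l) * z ^ (2 * l)).
Proof.
move=> x0 z0; rewrite /theta_term.
have z0' : z^-1 != 0 by rewrite invr_eq0.
have e1 : p ^ tri (k + l) * p ^ tri (k - l) = p ^ (k * k - k) * p ^ (l * l).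
  rewrite -!expfzDr //; congr (_ ^ _).
  by have := tri2 (k + l); have := tri2 (k - l); nia.
have e2 : x ^ (2 * k) = x ^ (k + l) * x ^ (k - l).
  by rewrite -expfzDr //; congr (_ ^ _); lia.
have e3 : z ^ (2 * l) = z ^ (k + l) * z^-1 ^ (k - l).
  by rewrite exprz_inv -expfzDr //; congr (_ ^ _); lia.
have e4 : (-1) ^ (k + l) * (-1) ^ (k - l) = 1 :> F.
  rewrite -expfzDr ?oppr_eq0 ?oner_eq0 //.
  have -> : k + l + (k - l) = 2 * k by lia.
  by rewrite -exprz_exp -exprnP sqrrN expr1n exp1rz.
rewrite !expfzMl e2 e3.
transitivity ((p ^ tri (k + l) * p ^ tri (k - l)) * ((-1) ^ (k + l) * (-1) ^ (k - l)) *
  ((x ^ (k + l) * x ^ (k - l)) * (z ^ (k + l) * z^-1 ^ (k - l)))).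
  by ring.
by rewrite e1 e4; ring.
Qed.

(** The same separation for m + n odd. *)
Lemma theta_term_odd x z k l : x != 0 -> z != 0 ->
  theta_term (x * z) (k + l + 1) * theta_term (x * z^-1) (k - l) =
  - (p ^ (k * k) * x ^ (2 * k + 1) * (p ^ (l * l + l) * z ^ (2 * l + 1))).
Proof.
move=> x0 z0; rewrite theta_termS ?mulf_neq0 // mulrAC theta_term_even //.
have -> : p ^ (k * k) = p ^ (k * k - k) * p ^ k.
  by rewrite -expfzDr //; congr (_ ^ _); lia.
rewrite !expfzDr // !expr1z; ring.
Qed.

End TruncatedTheta.

(** * The addition formula of theta functions *)

Section ThetaPluecker.

(** The Pluecker relation for c (a_x b_y - b_x a_y). *)
Lemma rank2_pluecker (F : comNzRingType) (c ax bx ay by_ az bz aw bw : F) :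
  c * (ax * by_ - bx * ay) * (c * (az * bw - bz * aw)) -
  c * (ax * bz - bx * az) * (c * (ay * bw - by_ * aw)) +
  c * (ax * bw - bx * aw) * (c * (ay * bz - by_ * az)) = 0.
Proof. by ring. Qed.

Context {R : realType}.
Local Notation C := R[i].

(** A sequence whose successive ratios are y r^k is summable: its ratio is
    eventually at most 1/2. *)
Lemma superexp_sum (c : nat -> R) (y r : R) : 0 <= y -> 0 <= r < 1 ->
  (forall k, 0 <= c k) -> (forall k, c k.+1 = c k * (y * r ^+ k)) ->
  exists A, forall n, \sum_(0 <= k < n) c k <= A.
Proof.
move=> y0 /andP[r0 r1] c0 cS.
have [k0 k0P] : exists k0, forall k, (k0 <= k)%N -> y * r ^+ k <= 2^-1.
  have h : (fun k => y * r ^+ k) @ \oo --> (0 : R).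
    rewrite -(mulr0 y); apply: rcvgM; first exact: rcvg_cst.
    by apply: cvg_expr; rewrite ger0_norm.
  have h2 : 0 < 2^-1 :> R by rewrite invr_gt0.
  have /cvgrPdist_le /(_ _ h2) [k0 _ k0P] := h.
  exists k0 => k /k0P /=; rewrite sub0r normrN; exact: le_trans (ler_norm _).
(* The sum of the terms before k0 + n plus twice the next term decreases
   with n. *)
have inv n : \sum_(0 <= k < k0 + n) c k + 2 * c (k0 + n)%N <=
   \sum_(0 <= k < k0) c k + 2 * c k0.
  elim: n => [|n IH]; first by rewrite addn0.
  rewrite addnS big_nat_recr //= cS; apply: le_trans IH.
  rewrite -addrA lerD2l.
  have := ler_wpM2l (c0 (k0 + n)%N) (k0P (k0 + n)%N (leq_addr _ _)).
  set a := c _ * (_ * _); set b := c (k0 + n)%N; lra.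
exists (\sum_(0 <= k < k0) c k + 2 * c k0) => n; apply: le_trans (inv n).
rewrite [(k0 + n)%N]addnC [X in _ <= X + _](big_cat_nat (n := n)) ?leq_addr //= -addrA lerDl addr_ge0 //.
  by apply: sumr_ge0.
by rewrite mulr_ge0.
Qed.

Variable p : C.
Hypothesis p0 : p != 0.
Hypothesis p1 : normc p < 1.

Let np0 : 0 <= normc p := normc_ge0 p.

Lemma theta_term_summable z : z != 0 -> exists A : R, forall t : seq int, uniq t ->
  \sum_(i <- t) normc (theta_term p z i) <= A.
Proof.
move=> z0.
pose b i := normc (theta_term p z i).
have b0 i : 0 <= b i by exact: normc_ge0.
have [||||A1 hA1] := @superexp_sum (fun k => b k%:Z) (normc z) (normc p) _ _ _ _.
- exact: normc_ge0.
- by rewrite np0.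
- by [].
- move=> k; rewrite /b -addn1 PoszD theta_termS // normcM; congr (_ * _).
  by rewrite normcM normc_opp -exprnP normcX.
have [||||A2 hA2] := @superexp_sum (fun k => b (- k%:Z)) (normc z^-1 * normc p) (normc p) _ _ _ _.
- by rewrite mulr_ge0 ?normc_ge0.
- by rewrite np0.
- by [].
- move=> k; rewrite /b.
  have h : p * p ^+ k * p ^ (- k.+1%:Z) = 1.
    by rewrite -exprS exprnP -expfzDr // addrN expr0z.
  have e : theta_term p z (- k%:Z) * (z^-1 * p * p ^+ k) = - theta_term p z (- k.+1%:Z).
    have -> : theta_term p z (- k%:Z) = theta_term p z (- k.+1%:Z) * (- z * p ^ (- k.+1%:Z)).
      by rewrite -theta_termS //; congr theta_term; lia.
    by rewrite -[RHS]mulr1 -h; field.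
  by rewrite -normcX -!normcM e normc_opp.
exists (A1 + A2) => t ut.
have [M tM] : exists M : nat, forall i, i \in t -> (`|i| < M)%N.
  exists (\sum_(i <- t) `|i|.+1)%N => i it.
  by rewrite (big_rem i) //= leq_addr.
apply: le_trans (_ : \sum_(0 <= k < M) b k%:Z + \sum_(0 <= k < M.+1) b (- k%:Z) <= _);
  last exact: lerD.
have -> : \sum_(0 <= k < M) b k%:Z = \sum_(i <- map (fun k : nat => k%:Z) (index_iota 0 M)) b i.
  by rewrite big_map.
apply: le_trans (_ : \sum_(i <- map (fun k : nat => k%:Z) (index_iota 0 M)) b i +
   \sum_(i <- map (fun k : nat => - k.+1%:Z) (index_iota 0 M)) b i <= _).
  rewrite -big_cat /=; apply: ler_sum_sub => //.
    rewrite cat_uniq !map_inj_uniq ?iota_uniq ?andbT /=; last 2 first.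
    - by move=> x y /oppr_inj [].
    - by move=> x y [].
    by apply/hasPn => _ /mapP[k _ ->]; apply/negP => /mapP[k' _]; lia.
  move=> i it; have := tM _ it; rewrite mem_cat => iM.
  case: i it iM => k _ iM; apply/orP; [left|right]; apply/mapP; exists k => //;
    by rewrite mem_index_iota; lia.
rewrite lerD2l big_map big_nat_recl //= lerDr //.
Qed.

Lemma theta_pair_summable u v : u != 0 -> v != 0 ->
  exists A : R, forall t : seq (int * int), uniq t ->
    \sum_(i <- t) normc (theta_term p u i.1 * theta_term p v i.2) <= A.
Proof.
move=> u0 v0.
have [A hA] := theta_term_summable u0; have [B hB] := theta_term_summable v0.
have A0 : 0 <= A by have := hA [::] isT; rewrite big_nil.
exists (A * B) => t ut.
apply: le_trans (_ : \sum_(i <- [seq (j, k) | j <- undup (map fst t), k <- undup (map snd t)])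
   normc (theta_term p u i.1 * theta_term p v i.2) <= _).
  apply: ler_sum_sub => //; last by move=> i; exact: normc_ge0.
    apply: allpairs_uniq; try exact: undup_uniq.
    by move=> [? ?] [? ?].
  move=> [j k] jk; apply/allpairsP; exists (j, k); rewrite /= !mem_undup; split => //.
    by apply/mapP; exists (j, k).
  by apply/mapP; exists (j, k).
rewrite big_allpairs /=.
under eq_bigr do under eq_bigr do rewrite normcM.
under eq_bigr do rewrite -mulr_sumr.
rewrite -mulr_suml; apply: ler_pM.
- by apply: sumr_ge0 => i _; exact: normc_ge0.
- by apply: sumr_ge0 => i _; exact: normc_ge0.
- exact/hA/undup_uniq.
- exact/hB/undup_uniq.
Qed.

Lemma pX_neq1 k : 1 - p ^+ k.+1 != 0.
Proof.
rewrite subr_eq0 eq_sym; apply/eqP => h.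
have : normc (p ^+ k.+1) = 1 by rewrite h normc1.
by rewrite normcX; apply/eqP; rewrite lt_eqF // exprn_ilt1.
Qed.

Lemma qfact_cvg : exists2 l : C, cvgC (qfact p) l &
  exists K, forall n, normc (qfact p n) <= K.
Proof.
have [||||l hl [_ lb]] := @cvgC_prod R nat (index_iota 0) (fun k => - p ^+ k.+1)
  (fun k => normc p * normc p ^+ k) (normc p / (1 - normc p)).
- by move=> n; exact: iota_uniq.
- by move=> m n mn k; rewrite !mem_index_iota => /andP[-> /leq_trans]; exact.
- by move=> k; rewrite normc_opp normcX exprS.
- by move=> n; rewrite -mulr_sumr ler_wpM2l // geo_sum_le // np0.
by exists l => //; exists (expR (normc p / (1 - normc p))).
Qed.

Lemma qfactV_cvg : exists2 l : C, cvgC (fun n => (qfact p n)^-1) l &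
  exists K, forall n, normc (qfact p n)^-1 <= K.
Proof.
pose d := 1 - normc p; have d0 : 0 < d by rewrite subr_gt0.
have E n : (qfact p n)^-1 = \prod_(k <- index_iota 0 n) (1 + p ^+ k.+1 / (1 - p ^+ k.+1)).
  rewrite /qfact -prodfV; apply: eq_bigr => k _.
  by have := pX_neq1 k => h; field.
have [||||l hl [_ lb]] := @cvgC_prod R nat (index_iota 0)
  (fun k => p ^+ k.+1 / (1 - p ^+ k.+1))
  (fun k => normc p / d * normc p ^+ k) (normc p / d * (1 - normc p)^-1).
- by move=> n; exact: iota_uniq.
- by move=> m n mn k; rewrite !mem_index_iota => /andP[-> /leq_trans]; exact.
- move=> k; rewrite normcM normcX normcV exprS mulrAC ler_pM //.
  + by rewrite mulr_ge0 // invr_ge0 normc_ge0.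
  + by rewrite exprn_ge0.
  apply: ler_wpM2l => //.
  have h : d <= normc (1 - p ^+ k.+1).
    have := normc_le0D (1 - p ^+ k.+1) (p ^+ k.+1); rewrite subrK normc1 normcX [normc p ^+ _]exprS.
    have : normc p * normc p ^+ k <= normc p by rewrite ler_piMr // exprn_ile1 // ltW.
    by rewrite /d; lra.
  by rewrite lef_pV2 ?posrE // (lt_le_trans d0).
- move=> n; rewrite -mulr_sumr ler_wpM2l ?geo_sum_le ?np0 //.
  by rewrite divr_ge0 // ltW.
exists l; first by apply: cvgC_eq hl => n; rewrite E.
by exists (expR (normc p / d * (1 - normc p)^-1)) => n; rewrite E.
Qed.

(** The q-binomial coefficients are bounded, and those of order 2 N at N + m
    converge to a limit that does not depend on the integer m. *)
Lemma qbin_cvg : exists2 c : C,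
  forall m : int, cvgC (fun N => qbin p (N + N) (absz (m + N%:Z)%R)) c &
  exists2 K, 0 < K & forall M j, normc (qbin p M j) <= K.
Proof.
have [l hl [K hK]] := qfact_cvg; have [l' hl' [K' hK']] := qfactV_cvg.
exists (l * l' * l').
  move=> m; apply: cvgCM.
    apply: cvgCM.
      apply: (@cvgC_reindex _ _ _ (fun N => N + N)%N _ hl) => M.
      by exists M => n Mn; lia.
    apply: (@cvgC_reindex _ _ _ (fun N : nat => (absz (m + N%:Z)%R)) _ hl') => M.
    by exists (M + `|m|)%N => n Mn; lia.
  apply: (@cvgC_reindex _ _ _ (fun N : nat => (N + N - (absz (m + N%:Z)%R))%N) _ hl') => M.
  by exists (M + `|m|)%N => n Mn; lia.
have K0 : 0 <= K := le_trans (normc_ge0 _) (hK 0%N).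
have K0' : 0 <= K' := le_trans (normc_ge0 _) (hK' 0%N).
exists (K * K' * K' + 1) => [|M j]; first by rewrite ltr_wpDl // !mulr_ge0.
apply: (@le_trans _ _ (K * K' * K')); last by rewrite lerDl.
by rewrite /qbin !normcM !ler_pM ?mulr_ge0 ?normc_ge0.
Qed.

(** The integers of absolute value at most N. *)
Definition lattice_range (N : nat) : seq int :=
  map (fun j : nat => j%:Z - N%:Z) (index_iota 0 (N + N).+1).

Lemma lattice_range_uniq N : uniq (lattice_range N).
Proof.
rewrite map_inj_uniq ?iota_uniq // => x y; lia.
Qed.

Lemma mem_lattice_range N i : (i \in lattice_range N) = (`|i| <= N)%N.
Proof.
apply/mapP/idP => [[j]|h]; first by rewrite mem_index_iota => h ->; lia.
by exists ((absz (i + N%:Z)%R)); rewrite ?mem_index_iota; lia.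
Qed.

(** The partial sums over |l| <= N of p^(l^2) z^(2 l). *)
Definition theta_even N (z : C) : C := \sum_(l <- lattice_range N) p ^ (l * l) * z ^ (2 * l).

(** The partial sums over |l| <= N of p^(l^2 + l) z^(2 l + 1). *)
Definition theta_odd N (z : C) : C :=
  \sum_(l <- lattice_range N) p ^ (l * l + l) * z ^ (2 * l + 1).

(** The bracket x^-1 theta_p(x z) theta_p(x / z). *)
Definition theta_br (x z : C) : C := x^-1 * pm1 (theta p) x z.

(** The bracket is a limit of brackets of rank two. *)
Lemma theta_br_cvg : exists c : C, forall x z, x != 0 -> z != 0 ->
  cvgC (fun N => c * (theta_odd N x * theta_even N z - theta_even N x * theta_odd N z))
    (theta_br x z).
Proof.
have [c0 hc0 [K K0 hK]] := qbin_cvg.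
exists (c0 * c0) => x z x0 z0.
have xz0 : x * z != 0 by rewrite mulf_neq0.
have xz0' : x * z^-1 != 0 by rewrite mulf_neq0 ?invr_eq0.
have [A hA] := theta_pair_summable xz0 xz0'.
pose a (i : int * int) := theta_term p (x * z) i.1 * theta_term p (x * z^-1) i.2.
pose s N := [seq (j, k) | j <- lattice_range N, k <- lattice_range N].
(* s1 and s2 list the pairs of exponents with even and with odd sum.  In s1
   the index k is shifted by 1, because x theta_odd(x) is the sum of the
   p^(k^2 - k) x^(2 k) over the shifted range. *)
pose s1 N := [seq (k + 1 + l, k + 1 - l) | k <- lattice_range N, l <- lattice_range N].
pose s2 N := [seq (k + l + 1, k - l) | k <- lattice_range N, l <- lattice_range N].
pose w (N : nat) (i : int * int) :=
  qbin p (N + N) (absz (i.1 + N%:Z)%R) * qbin p (N + N) (absz (i.2 + N%:Z)%R).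
have us N : uniq (s N).
  apply: allpairs_uniq; try exact: lattice_range_uniq.
  by move=> [? ?] [? ?].
have us' N : uniq (s1 N ++ s2 N).
  rewrite cat_uniq; apply/and3P; split.
  - apply: allpairs_uniq; try exact: lattice_range_uniq.
    by move=> [k l] [k' l'] _ _ /= [e1 e2]; congr (_, _); lia.
  - apply/hasPn => _ /allpairsP[[k l] /= [_ _ ->]].
    by apply/negP => /allpairsP[[k' l'] /= [_ _ [e1 e2]]]; lia.
  - apply: allpairs_uniq; try exact: lattice_range_uniq.
    by move=> [k l] [k' l'] _ _ /= [e1 e2]; congr (_, _); lia.
have KK : 0 < K * K by rewrite mulr_gt0.
have wK n i : i \in s n -> normc (w n i) <= K * K.
  by move=> _; rewrite normcM ler_pM ?normc_ge0.
have wc i : cvgC (fun n => if i \in s n then w n i else 0) (c0 * c0).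
  case: i => m n; apply: (@cvgC_near _ _ _ _ (`|m| + `|n|)%N _ (cvgCM (hc0 m) (hc0 n))) => N hN.
  rewrite (_ : (m, n) \in s N) //; apply/allpairsP; exists (m, n) => /=.
  by rewrite !mem_lattice_range; split => //; move: hN; clear; lia.
have cc i : cvgC (fun n => if i \in s1 n ++ s2 n then c0 * c0 else 0) (c0 * c0).
  case: i => m n.
  apply: (@cvgC_near _ _ _ _ (`|m| + `|n|).+2 _ (cvgC_cst (c0 * c0))) => N hN.
  rewrite (_ : (m, n) \in s1 N ++ s2 N) // mem_cat.
  have [k [km|km]] := int_parity (m + n).
  - apply/orP; left; apply/allpairsP; exists (k - 1, m - k) => /=.
    rewrite !mem_lattice_range; split; try by move: km hN; clear; lia.
    by move: km; clear; move=> km; congr (_, _); lia.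
  - apply/orP; right; apply/allpairsP; exists (k, m - k - 1) => /=.
    rewrite !mem_lattice_range; split; try by move: km hN; clear; lia.
    by move: km; clear; move=> km; congr (_, _); lia.
have T := tannery_exhaust KK hA us us' wK wc cc.
have [t1 _] := qpoch_cvg (x * z) p1.
have [t2 _] := qpoch_cvg (p * (x * z)^-1) p1.
have [t3 _] := qpoch_cvg (x * z^-1) p1.
have [t4 _] := qpoch_cvg (p * (x * z^-1)^-1) p1.
have h := cvgCM (cvgCM t1 t2) (cvgCM t3 t4).
have h2 : cvgC (fun N => \sum_(i <- s N) w N i * a i) (pm1 (theta p) x z).
  apply: cvgC_eq h => N; rewrite !theta_trunc_expand //; try exact: pX_neq1.
  rewrite big_allpairs /= mulr_suml /lattice_range big_map.
  apply: eq_bigr => j _; rewrite mulr_sumr big_map; apply: eq_bigr => k _.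
  by rewrite /w /a /= !subrK !absz_nat mulrACA.
have h3 := cvgCM (cvgC_cst x^-1) (cvgCB h2 T).
rewrite subr0 in h3; apply: cvgC_eq h3 => N.
rewrite opprB [X in x^-1 * X]addrC subrK mulrCA; congr (_ * _).
rewrite big_cat /= !big_allpairs_dep /=.
rewrite mulrDr /theta_odd /theta_even; congr (_ + _).
  rewrite mulr_suml mulr_sumr; apply: eq_bigr => k _.
  rewrite !mulr_sumr; apply: eq_bigr => l _.
  rewrite theta_term_even // -mulrA mulrA.
  have -> : (k + 1) * (k + 1) - (k + 1) = k * k + k by ring.
  have -> : 2 * (k + 1) = 1 + (2 * k + 1) by ring.
  by rewrite (expfzDr 1) // expr1z; field.
rewrite mulr_suml mulr_sumr -sumrN; apply: eq_bigr => k _.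
rewrite !mulr_sumr -sumrN; apply: eq_bigr => l _.
rewrite theta_term_odd // (expfzDr (2 * k) 1) // expr1z.
by field.
Qed.

Lemma theta_br_anti x y : x != 0 -> y != 0 -> theta_br x y = - theta_br y x.
Proof.
move=> x0 y0; have [c h] := theta_br_cvg.
apply: cvgC_unique (h x y x0 y0) _; apply: cvgC_eq (cvgCN (h y x y0 x0)) => N.
by rewrite -mulrN opprB (mulrC (theta_even N y)) (mulrC (theta_odd N y)).
Qed.

Lemma theta_br_pluecker x y z w : x != 0 -> y != 0 -> z != 0 -> w != 0 ->
  theta_br x y * theta_br z w - theta_br x z * theta_br y w +
  theta_br x w * theta_br y z = 0.
Proof.
move=> x0 y0 z0 w0; have [c h] := theta_br_cvg.
apply: cvgC_unique (cvgCD (cvgCB (cvgCM (h x y x0 y0) (h z w z0 w0))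
  (cvgCM (h x z x0 z0) (h y w y0 w0))) (cvgCM (h x w x0 w0) (h y z y0 z0))) _.
by apply: cvgC_eq (cvgC_cst 0) => N; rewrite rank2_pluecker.
Qed.

(** The first factor of (z; p) split off. *)
Lemma qpochS z : qpoch z p = (1 - z) * qpoch (p * z) p.
Proof.
have [h1 _] := qpoch_cvg z p1; have [h2 _] := qpoch_cvg (p * z) p1.
have hS : cvgC (fun N => \prod_(0 <= k < N.+1) (1 - z * p ^+ k)) (qpoch z p).
  by apply: (@cvgC_reindex _ _ _ S _ h1) => M; exists M => n; exact: leqW.
apply: cvgC_unique hS _; apply: cvgC_eq (cvgCM (cvgC_cst (1 - z)) h2) => N.
rewrite big_nat_recl // expr0 mulr1; congr (_ * _).
by apply: eq_bigr => k _; rewrite exprS; ring.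
Qed.

Lemma thetaV z : z != 0 -> theta p z^-1 = - z^-1 * theta p z.
Proof.
by move=> z0; rewrite /theta invrK (qpochS z) (qpochS z^-1); field.
Qed.

End ThetaPluecker.

(** * Bounded measurable functions and integrals over the torus *)

Section CircleFunctions.
Context {R : realType}.
Local Notation C := R[i].
Implicit Types f g h : R -> C.

(** Measurability of a complex-valued function of a real variable. *)
Definition measC f : Prop :=
  measurable_fun setT (fun x => complex.Re (f x)) /\
  measurable_fun setT (fun x => complex.Im (f x)).

Lemma measC_eq f g : f =1 g -> measC f -> measC g.
Proof. by move=> /funext ->. Qed.

Lemma measC_cst c : measC (fun=> c).
Proof. by split; exact: measurable_cst. Qed.

Lemma measCD f g : measC f -> measC g -> measC (fun x => f x + g x).
Proof.
move=> [h1 h2] [h3 h4]; split.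
  by under eq_fun do rewrite cReD; exact: measurable_funD.
by under eq_fun do rewrite cImD; exact: measurable_funD.
Qed.

Lemma measCM f g : measC f -> measC g -> measC (fun x => f x * g x).
Proof.
move=> [h1 h2] [h3 h4]; split.
  by under eq_fun do rewrite cReM; apply: measurable_funB; exact: measurable_funM.
by under eq_fun do rewrite cImM; apply: measurable_funD; exact: measurable_funM.
Qed.

Lemma measCN f : measC f -> measC (fun x => - f x).
Proof.
move=> h; apply: measC_eq (measCM (measC_cst (-1)) h) => x; by rewrite mulN1r.
Qed.

Lemma measCB f g : measC f -> measC g -> measC (fun x => f x - g x).
Proof. by move=> h1 h2; exact: measCD h1 (measCN h2). Qed.

(** The inverse is the conjugate divided by the squared modulus, and the inverse
    of a nonnegative real is its power of exponent -1, including at 0 where both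
    are 0. *)
Lemma measCV f : measC f -> measC (fun x => (f x)^-1).
Proof.
move=> [h1 h2].
pose n2 x := complex.Re (f x) ^+ 2 + complex.Im (f x) ^+ 2.
have mn : measurable_fun setT (fun x => (n2 x)^-1).
  have -> : (fun x => (n2 x)^-1) = (fun x => powR x (-1)) \o n2.
    by apply/funext => x; rewrite /= powR_inv1 // addr_ge0 ?sqr_ge0.
  apply: measurableT_comp; first exact: measurable_powR.
  by apply: measurable_funD; exact: measurable_funX.
split.
  have -> : (fun x => complex.Re (f x)^-1) = (fun x => complex.Re (f x) * (n2 x)^-1).
    by apply/funext => x; rewrite /n2; case: (f x).
  exact: measurable_funM.
have -> : (fun x => complex.Im (f x)^-1) = (fun x => - (complex.Im (f x) * (n2 x)^-1)).
  by apply/funext => x; rewrite /n2; case: (f x).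
by apply: measurable_funN; exact: measurable_funM.
Qed.

Lemma measC_prod (I : Type) (s : seq I) (P : pred I) (f : I -> R -> C) :
  (forall i, measC (f i)) -> measC (fun x => \prod_(i <- s | P i) f i x).
Proof.
move=> h; elim: s => [|i s IH].
  by apply: measC_eq (measC_cst 1) => x; rewrite big_nil.
under eq_fun do rewrite big_cons.
by case: (P i) => //; exact: measCM.
Qed.

Lemma measC_cvg (F : nat -> R -> C) f :
  (forall n, measC (F n)) -> (forall x, cvgC (F ^~ x) (f x)) -> measC f.
Proof.
move=> mF hF; split.
  apply: (@measurable_fun_cvg _ _ _ _ (fun n x => complex.Re (F n x))).
    by move=> n; exact: (mF n).1.
  by move=> x _; exact: (hF x).1.
apply: (@measurable_fun_cvg _ _ _ _ (fun n x => complex.Im (F n x))).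
  by move=> n; exact: (mF n).2.
by move=> x _; exact: (hF x).2.
Qed.

(** Bounded measurable functions.  They are integrable over bounded intervals, so
    that the contour integral is linear on the functions f for which f \o expi is
    of this kind. *)
Definition bmeasC f : Prop := measC f /\ exists M, forall x, normc (f x) <= M.

Lemma bmeasC_eq f g : f =1 g -> bmeasC f -> bmeasC g.
Proof. by move=> /funext ->. Qed.

Lemma bmeasC_cst c : bmeasC (fun=> c).
Proof. by split; [exact: measC_cst|exists (normc c)]. Qed.

Lemma bmeasCD f g : bmeasC f -> bmeasC g -> bmeasC (fun x => f x + g x).
Proof.
move=> [h1 [M hM]] [h2 [N hN]]; split; first exact: measCD.
by exists (M + N) => x; apply: le_trans (normc_le0D _ _) _; exact: lerD.
Qed.

Lemma bmeasCM f g : bmeasC f -> bmeasC g -> bmeasC (fun x => f x * g x).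
Proof.
move=> [h1 [M hM]] [h2 [N hN]]; split; first exact: measCM.
by exists (M * N) => x; rewrite normcM ler_pM ?normc_ge0.
Qed.

Lemma bmeasC_prod (I : Type) (s : seq I) (P : pred I) (f : I -> R -> C) :
  (forall i, bmeasC (f i)) -> bmeasC (fun x => \prod_(i <- s | P i) f i x).
Proof.
move=> h; elim: s => [|i s IH].
  by apply: bmeasC_eq (bmeasC_cst 1) => x; rewrite big_nil.
under eq_fun do rewrite big_cons.
by case: (P i) => //; exact: bmeasCM.
Qed.

(** Measurability passes to the limit of the partial products, and the bound on
    the infinite product is uniform; no continuity is needed. *)
Lemma bmeasC_qpoch p g : normc p < 1 -> bmeasC g -> bmeasC (fun x => qpoch (g x) p).
Proof.
move=> p1 [mg [M gM]]; split.
  apply: (measC_cvg (F := fun N x => \prod_(0 <= k < N) (1 - g x * p ^+ k))).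
    move=> N; apply: measC_prod => k.
    by apply: measCB; [exact: measC_cst|apply: measCM => //; exact: measC_cst].
  by move=> x; exact: (qpoch_cvg (g x) p1).1.
exists (expR (M / (1 - normc p))) => x.
apply: le_trans (qpoch_cvg (g x) p1).2 _.
by rewrite ler_expR ler_wpM2r // invr_ge0 subr_ge0 ltW.
Qed.

Lemma bmeasC_theta p g : normc p < 1 -> bmeasC g -> bmeasC (fun x => (g x)^-1) ->
  bmeasC (fun x => theta p (g x)).
Proof.
move=> p1 h1 h2; apply: bmeasCM; first exact: bmeasC_qpoch.
by apply: bmeasC_qpoch => //; apply: bmeasCM => //; exact: bmeasC_cst.
Qed.

(** The hypothesis |g| <= t < 1 keeps the arguments away from the poles. *)
Lemma bmeasC_egamma p q g (t : R) : normc p < 1 -> normc q < 1 -> t < 1 ->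
  (forall x, normc (g x) <= t) -> bmeasC g -> bmeasC (fun x => (g x)^-1) ->
  bmeasC (fun x => egamma p q (g x)).
Proof.
move=> p1 q1 t1 gt [mg _] [mg' [M gM]].
have d0 : 0 < 1 - t by rewrite subr_gt0.
have dP x j k : 1 - t <= normc (1 - g x * p ^+ j * q ^+ k).
  have h1 : normc (g x * p ^+ j * q ^+ k) <= t.
    rewrite !normcM !normcX -mulrA; apply: le_trans (gt x).
    rewrite ler_piMr ?normc_ge0 // mulr_ile1 ?exprn_ge0 ?normc_ge0 //;
      by rewrite exprn_ile1 ?normc_ge0 // ltW.
  have := normc_le0D (1 - g x * p ^+ j * q ^+ k) (g x * p ^+ j * q ^+ k).
  by rewrite subrK normc1; move: h1; lra.
split.
  apply: (measC_cvg (F := fun N x => gamma_trunc p q (g x) N)).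
    move=> N; apply: measC_prod => j; apply: measC_prod => k.
    apply: measCM; last apply: measCV; apply: measCB; try exact: measC_cst;
      by do 2 (apply: measCM; last exact: measC_cst).
  by move=> x; exact: (egamma_cvg p1 q1 d0 (dP x)).1.
exists (expR ((t + M) / (1 - t) * ((1 - normc p)^-1 * (1 - normc q)^-1))) => x.
apply: le_trans (egamma_cvg p1 q1 d0 (dP x)).2 _.
rewrite ler_expR; apply: ler_wpM2r.
  by rewrite mulr_ge0 // invr_ge0 subr_ge0 ltW.
apply: ler_wpM2r; first by rewrite invr_ge0 ltW.
exact: lerD.
Qed.

End CircleFunctions.

Section ContourLinearity.
Context {R : realType}.
Local Notation C := R[i].

Let D : set R := `[0, 2 * pi].

Lemma normc_expi (x : R) : normc (expi x) = 1.
Proof. by rewrite /expi /= cos2Dsin2 sqrtr1. Qed.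

Lemma bmeasC_expi : bmeasC (@expi R).
Proof.
split; last by exists 1 => x; rewrite normc_expi.
split; apply: continuous_measurable_fun; [exact: continuous_cos|exact: continuous_sin].
Qed.

Lemma bmeas_integrable (f : R -> R) (M : R) : measurable_fun setT f ->
  (forall x, `|f x| <= M) -> (@lebesgue_measure R).-integrable D (EFin \o f).
Proof.
move=> mf fM; apply: measurable_bounded_integrable.
- exact: measurable_itv.
- by rewrite /= lebesgue_measure_itv; case: ifP => //= _; rewrite -EFinB ltry.
- exact: measurable_funTS.
- exists M; split; first exact: num_real.
  by move=> y My x _; apply: le_trans (fM x) _; exact: ltW.
Qed.

Lemma bmeasC_integrable (f : R -> C) : bmeasC f ->
  (@lebesgue_measure R).-integrable D (EFin \o (fun x => complex.Re (f x))) /\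
  (@lebesgue_measure R).-integrable D (EFin \o (fun x => complex.Im (f x))).
Proof.
move=> [[h1 h2] [M hM]]; split; apply: (@bmeas_integrable _ M) => // x.
  exact: le_trans (Re_le_normc _) (hM x).
exact: le_trans (Im_le_normc _) (hM x).
Qed.

Lemma cRintegralD (f g : R -> C) : bmeasC f -> bmeasC g ->
  cRintegral D (fun x => f x + g x) = cRintegral D f + cRintegral D g.
Proof.
move=> /bmeasC_integrable[f1 f2] /bmeasC_integrable[g1 g2].
rewrite /cRintegral; apply/eqP; rewrite eq_complex /=.
rewrite -!RintegralD //; try exact: measurable_itv.
by apply/andP; split; apply/eqP; apply: eq_Rintegral => x _; rewrite ?cReD ?cImD.
Qed.

Lemma cRintegralZ (c : C) (f : R -> C) : bmeasC f ->
  cRintegral D (fun x => c * f x) = c * cRintegral D f.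
Proof.
move=> bf; have [f1 f2] := bmeasC_integrable bf.
rewrite /cRintegral; case: c => a b; apply/eqP; rewrite eq_complex /=.
have mD : measurable D by exact: measurable_itv.
have I k (u : R -> R) : (@lebesgue_measure R).-integrable D (EFin \o u) ->
   (@lebesgue_measure R).-integrable D (EFin \o (fun x => k * u x)).
  move=> hu; have -> : EFin \o (fun x => k * u x) = (fun x => k%:E * (EFin \o u) x)%E.
    by apply/funext => x; rewrite /= EFinM.
  exact: integrableZl.
rewrite -!RintegralZl // -RintegralB -?RintegralD //; try exact: I.
by apply/andP; split; apply/eqP; apply: eq_Rintegral => x _; case: (f x).
Qed.

Lemma circle_integral_ext (f g : C -> C) :
  (forall z, normc z = 1 -> f z = g z) -> circle_integral f = circle_integral g.
Proof.
move=> fg; rewrite /circle_integral; congr cRintegral.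
by apply/funext => x; rewrite fg // normc_expi.
Qed.

Lemma circle_integral_sum (I : Type) (s : seq I) (c : I -> C) (f : I -> C -> C) :
  (forall k, bmeasC (f k \o expi)) ->
  circle_integral (fun z => \sum_(k <- s) c k * f k z) =
  \sum_(k <- s) c k * circle_integral (f k).
Proof.
move=> bf.
have bI k : bmeasC (fun x => f k (expi x) * ('i * expi x)).
  by apply: bmeasCM (bf k) _; apply: bmeasCM bmeasC_expi; exact: bmeasC_cst.
have key t : bmeasC (fun x => (\sum_(k <- t) c k * f k (expi x)) * ('i * expi x)) /\
   circle_integral (fun z => \sum_(k <- t) c k * f k z) =
   \sum_(k <- t) c k * circle_integral (f k).
  elim: t => [|k t [IH1 IH2]].
    split; first by apply: bmeasC_eq (bmeasC_cst 0) => x; rewrite big_nil mul0r.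
    rewrite big_nil /circle_integral; transitivity (cRintegral D (fun=> 0 * (0 : C))).
      by congr cRintegral; apply/funext => x; rewrite big_nil !mul0r.
    by rewrite (cRintegralZ 0 (bmeasC_cst 0)) mul0r.
  have b1 : bmeasC (fun x => c k * (f k (expi x) * ('i * expi x))).
    by apply: bmeasCM => //; exact: bmeasC_cst.
  split.
    by apply: bmeasC_eq (bmeasCD b1 IH1) => x; rewrite big_cons mulrDl -mulrA.
  rewrite big_cons -IH2 /circle_integral -cRintegralZ // -cRintegralD //.
  by congr cRintegral; apply/funext => x; rewrite big_cons mulrDl -mulrA.
exact: (key s).2.
Qed.

Lemma torus_integral_ext n (F G : n.-tuple C -> C) :
  (forall z, (forall i, normc (tnth z i) = 1) -> F z = G z) ->
  torus_integral F = torus_integral G.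
Proof.
elim: n F G => [|n IH] F G FG; first by apply: FG => -[].
apply: circle_integral_ext => z z1; apply: IH => w w1; apply: FG => i.
case: (unliftP ord0 i) => [j ->|->]; last by rewrite tnth0.
by rewrite tnthS w1.
Qed.

(** Integrals of sums of products of one-variable functions: each variable is
    integrated separately. *)
Lemma torus_integral_sum_prod n (I : Type) (s : seq I) (c : I -> C)
  (f : I -> 'I_n -> C -> C) :
  (forall k j, bmeasC (f k j \o expi)) ->
  torus_integral (fun z : n.-tuple C =>
    \sum_(k <- s) c k * \prod_(j < n) f k j (tnth z j)) =
  \sum_(k <- s) c k * \prod_(j < n) circle_integral (f k j).
Proof.
elim: n c f => [|n IH] c f bf /=.
  by apply: eq_bigr => k _; rewrite !big_ord0.
transitivity (circle_integral (fun z => \sum_(k <- s)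
   (c k * \prod_(j < n) circle_integral (f k (lift ord0 j))) * f k ord0 z)).
  congr circle_integral; apply/funext => z.
  transitivity (torus_integral (fun w : n.-tuple C =>
     \sum_(k <- s) (c k * f k ord0 z) * \prod_(j < n) f k (lift ord0 j) (tnth w j))).
    congr torus_integral; apply/funext => w; apply: eq_bigr => k _.
    rewrite big_ord_recl tnth0 mulrA; congr (_ * _).
    by apply: eq_bigr => j _; rewrite tnthS.
  rewrite (IH (fun k => c k * f k ord0 z) (fun k j => f k (lift ord0 j))) //.
  by apply: eq_bigr => k _; ring.
rewrite circle_integral_sum //; apply: eq_bigr => k _.
by rewrite big_ord_recl; ring.
Qed.

End ContourLinearity.

(** * The determinant formula *)

Section FieldIdentities.
(* Rearrangements used below, over an arbitrary field. *)
Variable F : fieldType.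

Lemma bracket_pair_regroup (z w x1 x2 y1 y2 : F) : z != 0 -> w != 0 ->
  (x1 * (- (z * w)^-1 * y1)) * (x2 * (- (z / w)^-1 * y2)) =
  z^-1 * (x1 * x2) * (z^-1 * (y1 * y2)).
Proof. by move=> z0 w0; field; rewrite z0 w0. Qed.

Lemma prod_of_two_dets (s a b x y : F) : s * s = 1 -> a != 0 -> b != 0 ->
  x * y = (a * b)^-1 * ((s * a * x) * (s * b * y)).
Proof.
move=> s1 a0 b0; rewrite -[LHS]mul1r -s1; field; by rewrite a0 b0.
Qed.

Lemma permutation_term_regroup (c s u x y w : F) :
  c * (s * x * (u * y) * w) = c * (s * u) * (x * y * w).
Proof. by ring. Qed.

Lemma weight_regroup (w1 w2 w3 x y : F) : w1 / w2 * x * y * w3 = x * y * (w1 / w2 * w3).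
Proof. by ring. Qed.

Lemma scale_det_factor (x y f d : F) n : f != 0 -> (2 : F) != 0 ->
  x ^+ n * y ^+ n / (2 ^+ n * f) * (f * d) = (x * y / 2) ^+ n * d.
Proof.
move=> f0 h2; have h2n : (2 : F) ^+ n != 0 by rewrite expf_neq0.
by rewrite !exprMn exprVn; field; rewrite f0 h2n.
Qed.

End FieldIdentities.

Section Determinants.
Context {R : realType}.
Local Notation C := R[i].

(** The interpolation determinant for theta functions.  The products
    prod_{k <> i} a_k are taken out of the rows to pass to brackets. *)
Lemma det_theta p n (a z : 'I_n -> C) : p != 0 -> normc p < 1 ->
  (forall i, a i != 0) -> (forall i, z i != 0) ->
  (forall i j : 'I_n, (i < j)%N -> pm1 (theta p) (a i) (a j) != 0) ->
  \det (\matrix_(i < n, j < n) \prod_(k < n | k != i) pm1 (theta p) (a k) (z j)) =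
  pair_sign C n *
  (\prod_(i < n) \prod_(j < n | (i < j)%N) (a j * pm1 (theta p) (a i) (a j))) *
  (\prod_(i < n) \prod_(j < n | (i < j)%N) theta_br p (z i) (z j)).
Proof.
move=> p0 p1 a0 z0 aij.
have E x y : x != 0 -> pm1 (theta p) x y = x * theta_br p x y.
  by move=> x0; rewrite /theta_br mulrA divff // mul1r.
have -> : \matrix_(i, j) (\prod_(k < n | k != i) pm1 (theta p) (a k) (z j)) =
  diag_mx (\row_i \prod_(k < n | k != i) a k) *m
  \matrix_(i, j) \prod_(k < n | k != i) theta_br p (a k) (z j).
  apply/matrixP => i j; rewrite mul_diag_mx !mxE -big_split /=.
  by apply: eq_bigr => k _; rewrite E.
rewrite det_mulmx det_diag.
rewrite (@det_bracket _ _ (fun x : C => x != 0)) //; first last.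
- by move=> i j ij; have := aij i j ij; rewrite E // mulf_eq0 negb_or => /andP[].
- by move=> x y z' w *; exact: theta_br_pluecker.
- by move=> x y *; exact: theta_br_anti.
under eq_bigr do rewrite mxE.
rewrite (prod_pairsC (fun k j => a k)).
have -> : \prod_(i < n) \prod_(j < n | (i < j)%N) (a j * pm1 (theta p) (a i) (a j)) =
  (\prod_(i < n) \prod_(j < n | (i < j)%N) a i) *
  (\prod_(i < n) \prod_(j < n | (i < j)%N) a j) *
  (\prod_(i < n) \prod_(j < n | (i < j)%N) theta_br p (a i) (a j)).
  rewrite -!big_split; apply: eq_bigr => i _ /=.
  rewrite -!big_split; apply: eq_bigr => j _ /=.
  by rewrite E //; ring.
by ring.
Qed.

(** Summing over two permutations a product that depends only on their relative
    position counts each permutation n! times. *)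
Lemma andreief (n : nat) (N : 'I_n -> 'I_n -> C) :
  \sum_(s : 'S_n * 'S_n) (-1) ^+ s.1 * (-1) ^+ s.2 * \prod_(j < n) N (s.1 j) (s.2 j) =
  n`!%:R * \det (\matrix_(i, j) N i j).
Proof.
rewrite -(pair_big xpredT xpredT (fun s t : 'S_n => 
  (-1) ^+ s * (-1) ^+ t * \prod_(j < n) N (s j) (t j))) /=.
transitivity (\sum_(s : 'S_n) \det (\matrix_(i, j) N i j)); last first.
  by rewrite sumr_const card_Sn mulr_natl.
apply: eq_bigr => s _.
transitivity ((-1) ^+ s * \det (row_perm s (\matrix_(i, j) N i j))).
  rewrite /determinant mulr_sumr; apply: eq_bigr => t _.
  rewrite -mulrA; congr (_ * (_ * _)); apply: eq_bigr => j _.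
  by rewrite !mxE.
rewrite row_permE det_mulmx det_perm mulrA -expr2 sqrr_sign mul1r //.
Qed.

(** The cross factors of the integrand are products of brackets in base p and in
    base q. *)
Lemma pmpm_gamma (p q z w : C) : p != 0 -> q != 0 -> normc p < 1 -> normc q < 1 ->
  normc z = 1 -> normc w = 1 ->
  (pmpm (egamma p q) z w)^-1 = theta_br p z w * theta_br q z w.
Proof.
move=> p0 q0 p1 q1 z1 w1.
have neq0 (x : C) : normc x = 1 -> x != 0.
  by move=> x1; apply/eqP => x0; move: x1; rewrite x0 normc0 => /eqP; rewrite eq_sym oner_eq0.
have z0 := neq0 _ z1; have w0 := neq0 _ w1.
have zw1 : normc (z * w) = 1 by rewrite normcM z1 w1 mulr1.
have zw1' : normc (z / w) = 1 by rewrite normcM normcV z1 w1 invr1 mulr1.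
have -> : pmpm (egamma p q) z w =
    (egamma p q (z * w) * egamma p q (z * w)^-1) *
    (egamma p q (z / w) * egamma p q (z / w)^-1).
  by rewrite /pmpm invf_div invfM (mulrC w); ring.
rewrite invfM !egamma_reflect // !thetaV ?mulf_neq0 ?invr_eq0 //.
exact: bracket_pair_regroup.
Qed.

Section Weight.
Variables (p q : C).
Hypotheses (p1 : normc p < 1) (q1 : normc q < 1).

Lemma bmeasC_expiV : bmeasC (fun x : R => (expi x)^-1).
Proof.
split; first by apply: measCV; exact: (bmeasC_expi (R := R)).1.
by exists 1 => x; rewrite normcV normc_expi invr1.
Qed.

Lemma bmeasC_scale (c : C) : bmeasC (fun x : R => c * expi x).
Proof. by apply: bmeasCM; [exact: bmeasC_cst|exact: bmeasC_expi]. Qed.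

Lemma bmeasC_scaleV (c : C) : bmeasC (fun x : R => c * (expi x)^-1).
Proof. by apply: bmeasCM; [exact: bmeasC_cst|exact: bmeasC_expiV]. Qed.

Lemma bmeasC_pm1_theta r a : normc r < 1 -> bmeasC (fun x : R => pm1 (theta r) a (expi x)).
Proof.
move=> r1; apply: bmeasCM; apply: bmeasC_theta => //.
- exact: bmeasC_scale.
- by under eq_fun do rewrite invfM; exact: bmeasC_scaleV.
- exact: bmeasC_scaleV.
- by under eq_fun do rewrite invfM invrK; exact: bmeasC_scale.
Qed.

Lemma bmeasC_pm1_egamma t : normc t < 1 -> bmeasC (fun x : R => pm1 (egamma p q) t (expi x)).
Proof.
move=> t1; apply: bmeasCM; apply: (bmeasC_egamma (t := normc t)) => //.
- by move=> x; rewrite normcM normc_expi mulr1.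
- exact: bmeasC_scale.
- by under eq_fun do rewrite invfM; exact: bmeasC_scaleV.
- by move=> x; rewrite normcM normcV normc_expi invr1 mulr1.
- exact: bmeasC_scaleV.
- by under eq_fun do rewrite invfM invrK; exact: bmeasC_scale.
Qed.

(** By reflection, 1 / Gamma(z^{+-2}) is a product of theta functions on the unit
    circle, hence bounded although Gamma has poles at z = 1 and z = -1. *)
Lemma bmeasC_pm2_egammaV : bmeasC (fun x : R => (pm2 (egamma p q) (expi x))^-1).
Proof.
have b2 : bmeasC (fun x : R => expi x ^+ 2).
  by apply: bmeasCM; exact: bmeasC_expi.
have b2V : bmeasC (fun x : R => (expi x ^+ 2)^-1).
  by under eq_fun do rewrite -exprVn; apply: bmeasCM; exact: bmeasC_expiV.
apply: (@bmeasC_eq _ (fun x => theta p (expi x ^+ 2) * theta q (expi x ^+ 2)^-1)).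
  by move=> x; rewrite -egamma_reflect // normcX normc_expi expr1n.
apply: bmeasCM; apply: bmeasC_theta => //.
by under eq_fun do rewrite invrK.
Qed.

End Weight.

End Determinants.

Theorem mainTheorem6 (R : realType) (p q : R[i])
  (hp : 0 < `|p| < 1) (hq : 0 < `|q| < 1)
  (n m : nat) (hn : (1 <= n)%N)
  (t : 'I_(2 * n + 2 * m + 4) -> R[i])
  (ht0 : forall r, t r != 0) (ht1 : forall r, `|t r| < 1)
  (hbal : \prod_(r < 2 * n + 2 * m + 4) t r = (p * q) ^+ (m + 1))
  (a b : 'I_n -> R[i])
  (ha0 : forall i, a i != 0) (hb0 : forall i, b i != 0)
  (ha : forall i j : 'I_n, (i < j)%N -> pm1 (theta p) (a i) (a j) != 0)
  (hb : forall i j : 'I_n, (i < j)%N -> pm1 (theta q) (b i) (b j) != 0) :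
  ell_integral p q n m t =
  (\prod_(i < n) \prod_(j < n | (i < j)%N)
     (a j * pm1 (theta p) (a i) (a j) * (b j * pm1 (theta q) (b i) (b j)))^-1) *
  \det (\matrix_(i < n, j < n)
    (qpoch p p * qpoch q q / 2 *
     circle_integral (fun z : R[i] =>
       (\prod_(r < 2 * n + 2 * m + 4) pm1 (egamma p q) (t r) z)
         / pm2 (egamma p q) z
         * (\prod_(k < n | k != i) pm1 (theta p) (a k) z)
         * (\prod_(k < n | k != j) pm1 (theta q) (b k) z)
         * (two_pi_i * z)^-1))).
Proof.
have p1 : normc p < 1 by case/andP: hp => _; rewrite normCE ltcR.
have q1 : normc q < 1 by case/andP: hq => _; rewrite normCE ltcR.
have p0 : p != 0 by case/andP: hp; rewrite normr_gt0.
have q0 : q != 0 by case/andP: hq; rewrite normr_gt0.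
have t1 r : normc (t r) < 1 by have := ht1 r; rewrite normCE ltcR.
(* A and B are the interpolating products of theta functions, W is the common
   weight, N the matrix of one-variable integrals without the factor kappa. *)
pose A (i : 'I_n) z := \prod_(k < n | k != i) pm1 (theta p) (a k) z.
pose B (i : 'I_n) z := \prod_(k < n | k != i) pm1 (theta q) (b k) z.
pose W z := (\prod_(r < 2 * n + 2 * m + 4) pm1 (egamma p q) (t r) z)
         / pm2 (egamma p q) z * (two_pi_i * z)^-1.
pose N i k := circle_integral (fun z => A i z * B k z * W z).
pose PA := \prod_(i < n) \prod_(j < n | (i < j)%N) (a j * pm1 (theta p) (a i) (a j)).
pose PB := \prod_(i < n) \prod_(j < n | (i < j)%N) (b j * pm1 (theta q) (b i) (b j)).
have PA0 : PA != 0.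
  by apply/prodf_neq0 => i _; apply/prodf_neq0 => j ij; rewrite mulf_neq0 ?ha.
have PB0 : PB != 0.
  by apply/prodf_neq0 => i _; apply/prodf_neq0 => j ij; rewrite mulf_neq0 ?hb.
have bW : bmeasC (W \o expi).
  apply: bmeasCM; last first.
    rewrite (_ : (fun x => _) = fun x => two_pi_i^-1 * (expi x)^-1).
      exact: bmeasC_scaleV.
    by apply/funext => x; rewrite invfM.
  apply: bmeasCM; last exact: bmeasC_pm2_egammaV.
  by apply: bmeasC_prod => r; exact: bmeasC_pm1_egamma.
have bA i : bmeasC (A i \o expi) by apply: bmeasC_prod => k; exact: bmeasC_pm1_theta.
have bB i : bmeasC (B i \o expi) by apply: bmeasC_prod => k; exact: bmeasC_pm1_theta.
have torusE : torus_integral (fun z : n.-tuple R[i] =>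
    (\prod_(i < n) \prod_(j < n | (i < j)%N)
       (pmpm (egamma p q) (tnth z i) (tnth z j))^-1) *
    \prod_(j < n)
      ((\prod_(i < 2 * n + 2 * m + 4) pm1 (egamma p q) (t i) (tnth z j))
         / pm2 (egamma p q) (tnth z j)
         * (two_pi_i * tnth z j)^-1)) =
  (PA * PB)^-1 * (n`!%:R * \det (\matrix_(i, j) N i j)).
  rewrite -andreief mulr_sumr.
  transitivity (torus_integral (fun z : n.-tuple R[i] =>
    \sum_(s : 'S_n * 'S_n) (PA * PB)^-1 * ((-1) ^+ s.1 * (-1) ^+ s.2) *
      \prod_(j < n) (A (s.1 j) (tnth z j) * B (s.2 j) (tnth z j) * W (tnth z j)))).
    apply: torus_integral_ext => z z1.
    have z0 i : tnth z i != 0.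
      apply/eqP => z0; have := z1 i; rewrite z0 normc0 => /eqP.
      by rewrite eq_sym oner_eq0.
    pose VA := \prod_(i < n) \prod_(j < n | (i < j)%N) theta_br p (tnth z i) (tnth z j).
    pose VB := \prod_(i < n) \prod_(j < n | (i < j)%N) theta_br q (tnth z i) (tnth z j).
    have dA : \det (\matrix_(i < n, j < n) A i (tnth z j)) = pair_sign R[i] n * PA * VA.
      exact: det_theta p0 p1 ha0 z0 ha.
    have dB : \det (\matrix_(i < n, j < n) B i (tnth z j)) = pair_sign R[i] n * PB * VB.
      exact: det_theta q0 q1 hb0 z0 hb.
    transitivity (VA * VB * \prod_(j < n) W (tnth z j)).
      congr (_ * _); rewrite -big_split; apply: eq_bigr => i _ /=.
      by rewrite -big_split; apply: eq_bigr => j _ /=; rewrite pmpm_gamma.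
    transitivity ((PA * PB)^-1 *
       (\det (\matrix_(i < n, j < n) A i (tnth z j))^T *
        \det (\matrix_(i < n, j < n) B i (tnth z j))^T) * \prod_(j < n) W (tnth z j)).
      congr (_ * _).
      apply: etrans (prod_of_two_dets _ _ (pair_signM R[i] n) PA0 PB0) _.
      congr (_ * (_ * _)); rewrite det_tr; [exact: esym dA|exact: esym dB].
    (* Transposed, the determinants expand as signed sums of products over the
       variables z_j. *)
    rewrite /determinant big_distrlr /= pair_big /= -mulrA mulr_suml mulr_sumr.
    apply: eq_bigr => -[s u] _ /=.
    transitivity ((PA * PB)^-1 * ((-1) ^+ s * (\prod_(j < n) A (s j) (tnth z j)) *
        ((-1) ^+ u * \prod_(j < n) B (u j) (tnth z j)) * \prod_(j < n) W (tnth z j))).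
      by congr (_ * (_ * _ * (_ * _) * _)); apply: eq_bigr => j _; rewrite !mxE.
    by rewrite [in RHS]big_split [in RHS]big_split /=; exact: permutation_term_regroup.
  rewrite (@torus_integral_sum_prod _ _ _ _ (fun s : 'S_n * 'S_n => (PA * PB)^-1 * ((-1) ^+ s.1 * (-1) ^+ s.2))
    (fun s j z => A (s.1 j) z * B (s.2 j) z * W z)).
    by apply: eq_bigr => s _; rewrite -[LHS]mulrA.
  by move=> s j; exact: bmeasCM (bmeasCM (bA (s.1 j)) (bB (s.2 j))) bW.
rewrite /ell_integral torusE.
have -> : \prod_(i < n) \prod_(j < n | (i < j)%N)
     (a j * pm1 (theta p) (a i) (a j) * (b j * pm1 (theta q) (b i) (b j)))^-1 =
  (PA * PB)^-1.
  rewrite -big_split /= -prodfV; apply: eq_bigr => i _.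
  by rewrite -big_split /= -prodfV; apply: eq_bigr => j _.
have -> : \matrix_(i < n, j < n)
    (qpoch p p * qpoch q q / 2 *
     circle_integral (fun z : R[i] =>
       (\prod_(r < 2 * n + 2 * m + 4) pm1 (egamma p q) (t r) z)
         / pm2 (egamma p q) z
         * (\prod_(k < n | k != i) pm1 (theta p) (a k) z)
         * (\prod_(k < n | k != j) pm1 (theta q) (b k) z)
         * (two_pi_i * z)^-1)) =
  (qpoch p p * qpoch q q / 2) *: \matrix_(i, j) N i j.
  apply/matrixP => i j; rewrite !mxE; congr (_ * _).
  by apply: circle_integral_ext => z _; exact: weight_regroup.
rewrite detZ mulrCA; congr (_ * _).
by apply: scale_det_factor; rewrite pnatr_eq0 // -lt0n fact_gt0.
Qed.
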